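(* Consider the representation of the algebra $\mathrm{AW}_2$ on $V_1\otimes V_2$ and the basis $\{\psi_{n_1}^{n_2}\otimes\psi_{n_2}\}$ of $V_1\otimes V_2$ described in the context, on which $L_2$ acts as the 9-term operator $$L_2(\psi_{n_1}^{n_2}\otimes\psi_{n_2})=a_{n_1,n_2}\,\psi_{n_1-1}^{n_2-1}\otimes\psi_{n_2-1}+b_{n_1,n_2}\,\psi_{n_1-1}^{n_2}\otimes\psi_{n_2}+c_{n_1,n_2}\,\psi_{n_1-1}^{n_2+1}\otimes\psi_{n_2+1}$$ $$+d_{n_1,n_2}\,\psi_{n_1}^{n_2-1}\otimes\psi_{n_2-1}+e_{n_1,n_2}\,\psi_{n_1}^{n_2}\otimes\psi_{n_2}+d_{n_1,n_2+1}\,\psi_{n_1}^{n_2+1}\otimes\psi_{n_2+1}$$ $$+c_{n_1+1,n_2-1}\,\psi_{n_1+1}^{n_2-1}\otimes\psi_{n_2-1}+b_{n_1+1,n_2}\,\psi_{n_1+1}^{n_2}\otimes\psi_{n_2}+a_{n_1+1,n_2+1}\,\psi_{n_1+1}^{n_2+1}\otimes\psi_{n_2+1}.$$ The coefficients are given by $$a_{n_1,n_2}=\frac{a_{n_1}(\boldsymbol\alpha_{L_1}^{n_2})\,d_{n_1-1,n_2}-a_{n_1}(\boldsymbol\alpha_{L_1}^{n_2-1})\,d_{n_1,n_2}}{b_{n_1-1}(\boldsymbol\alpha_{L_1}^{n_2-1})-b_{n_1}(\boldsymbol\alpha_{L_1}^{n_2})},$$ $$b_{n_1,n_2}=\frac{a_{n_1}(\boldsymbol\alpha_{L_1}^{n_2})\big(A_0\lambda_{n_2}+\cosh_q(1)A_{N_2}\big)}{\cosh_q(2n_2+\alpha_0-1)\cosh_q(2n_2+\alpha_0+1)},$$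 $$c_{n_1,n_2}=\frac{a_{n_1}(\boldsymbol\alpha_{L_1}^{n_2})\,d_{n_1-1,n_2+1}-a_{n_1}(\boldsymbol\alpha_{L_1}^{n_2+1})\,d_{n_1,n_2+1}}{b_{n_1-1}(\boldsymbol\alpha_{L_1}^{n_2+1})-b_{n_1}(\boldsymbol\alpha_{L_1}^{n_2})},$$ $$d_{n_1,n_2}=\frac{\tilde a_{n_2}(\boldsymbol\alpha_{M_2}^{n_1})\big(\cosh_q(1)A_1-A_2\lambda_{n_1}\big)}{\cosh_q(2n_1+\alpha_0-1)\cosh_q(2n_1+\alpha_0+1)},$$ $$e_{n_1,n_2}=\frac{\tilde b_{n_2}(\boldsymbol\alpha_{M_2}^{n_1})\big(\cosh_q(1)A_1-A_2\lambda_{n_1}\big)+A_0\big(A_1\lambda_{n_1}+\cosh_q(1)A_2\big)}{\cosh_q(2n_1+\alpha_0-1)\cosh_q(2n_1+\alpha_0+1)},$$ where $\boldsymbol\alpha_{L_1}^{n_2}=(\alpha_0+2n_2,\alpha_1,\alpha_2,-N_1-1)$, $\boldsymbol\alpha_{M_2}^{n_1}=(\alpha_0,-N_1-1,-\alpha_0-2n_1,-N_2-1)$, and the functions $a_n,b_n,\tilde a_n,\tilde b_n$ of a vector in $\mathbb{R}^4$ are given in the context.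
   Context: Notation: $0<q<1$, $\sinh_q(x)=q^x-q^{-x}$, $\cosh_q(x)=q^x+q^{-x}$. Coefficient functions: for $\boldsymbol\beta=(\beta_0,\beta_1,\beta_2,\beta_3)\in\mathbb{R}^4$, $a_n(\boldsymbol\beta)$ is a square root of $$a_n^2(\boldsymbol\beta)=\frac{-\prod_{k=0}^3\big(\sinh_q(2n+\beta_0-1)-\sinh_q(p_k)\big)}{\cosh_q(2n+\beta_0-1)^2\cosh_q(2n+\beta_0)\cosh_q(2n+\beta_0-2)},$$ with $p_0=\beta_0+\beta_3$, $p_1=\beta_0-\beta_3$, $p_2=\beta_1+\beta_2$, $p_3=\beta_1-\beta_2$; $$b_n(\boldsymbol\beta)=\frac{(B_0B_1-B_2B_3)\sinh_q(2n+\beta_0)+\cosh_q(1)(B_1B_3+B_0B_2)}{\cosh_q(2n+\beta_0-1)\cosh_q(2n+\beta_0+1)},$$ with $B_0=\sinh_q(\beta_0)$, $B_1=\sinh_q(\beta_1)$, $B_2=\cosh_q(\beta_2)$, $B_3=\cosh_q(\beta_3)$. Further, $\tilde a_n(\boldsymbol\beta)$ is a square root of $\tilde a_n^2(\beta_0,\beta_1,\beta_2,\beta_3)=-a_n^2(\beta_0,\beta_2,\beta_1,\beta_3)$, and $$\tilde b_n(\boldsymbol\beta)=\frac{(\tilde B_0\tilde B_1-\tilde B_2\tilde B_3)\sinh_q(2n+\beta_0)+\cosh_q(1)(\tilde B_1\tilde B_3+\tilde B_0\tilde B_2)}{\cosh_q(2n+\beta_0-1)\cosh_q(2n+\beta_0+1)},$$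 with $\tilde B_0=\sinh_q(\beta_0)$, $\tilde B_1=\cosh_q(\beta_1)$, $\tilde B_2=\sinh_q(\beta_2)$, $\tilde B_3=\cosh_q(\beta_3)$. AW-relations: for elements $K,L,A_0,\dots,A_5$ of a unital algebra, $\mathscr{AW}(K,L\mid A_0,\dots,A_5)=0$ means $$\cosh_q(2)KLK-K^2L-LK^2=(\sinh_q(1))^2(A_0A_1-A_2A_3)K-(\cosh_q(1))^2A_5L+\cosh_q(1)(A_1A_3A_5+(\sinh_q(1))^2A_0A_2),$$ $$\cosh_q(2)LKL-L^2K-KL^2=(\sinh_q(1))^2(A_0A_1-A_2A_3)L-(\cosh_q(1))^2A_4K+\cosh_q(1)(A_0A_3A_4+(\sinh_q(1))^2A_1A_2).$$ The structure parameters $A_0,\dots,A_5$ are locally central if they commute with each other and with $K$ and $L$. The algebra $\mathrm{AW}_2$, for real constants $A_0,A_1,A_2,A_{N_1},A_{N_2},\sigma_K,\sigma_L$: for $i=1,2$ let $\mathrm{AW}_1(A_{N_i})$ be the unital algebra generated by $K_1,L_1$ with $\mathscr{AW}(K_1,L_1\mid A_0,A_1,A_2,A_{N_i},\sigma_L,\sigma_K)=0$; let $\mathscr{A}=\mathrm{AW}_1(A_{N_1})\otimes\mathrm{AW}_1(A_{N_2})$; let $\mathrm{AW}_1(M_2)$ be the unital algebra generated by $K_2,L_2$ and a central element $M_2$ with $\mathscr{AW}(K_2,L_2\mid A_0,A_1,A_2,M_2,\sigma_L,\sigma_K)=0$. Then $\mathrm{AW}_2$ is the unital associative complex algebra generated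 by $\mathscr{A}$ and $\mathrm{AW}_1(M_2)$ (free product) subject to $$\mathscr{AW}(1\otimes K_1,L_2\mid A_0,L_1\otimes1,A_2,A_{N_2},\sigma_L,\sigma_K)=0,\qquad \mathscr{AW}(K_2,L_1\otimes1\mid1\otimes K_1,A_1,A_2,A_{N_1},\sigma_L,\sigma_K)=0,$$ $$\mathscr{AW}(1\otimes K_1,M_2\mid A_0,A_{N_1},-K_2,A_{N_2},-(\sinh_q(1))^2,\sigma_K)=0,\qquad \mathscr{AW}(M_2,L_1\otimes1\mid A_{N_2},A_1,-L_2,A_{N_1},\sigma_L,-(\sinh_q(1))^2)=0,$$ where in each relation all structure parameters are locally central. The representation: $N_1,N_2\in\mathbb{Z}_{\ge0}$, $\alpha_0,\alpha_1,\alpha_2\in\mathbb{R}$, $A_0=\sinh_q(\alpha_0)$, $A_1=\sinh_q(\alpha_1)$, $A_2=\cosh_q(\alpha_2)$, $A_{N_i}=\cosh_q(-N_i-1)$, $\sigma_K=\sigma_L=(\sinh_q(1))^2$, $\lambda_x=\sinh_q(2x+\alpha_0)$, $\mu_x=\sinh_q(2x+\alpha_1)$. $V_1,V_2$ are complex inner product spaces with $\dim V_i=N_i+1$, and $V_1\otimes V_2$ has the product inner product. $\mathrm{AW}_2$ acts on $V_1\otimes V_2$ so that $\mathscr{A}$ acts as the tensor product of representations of $\mathrm{AW}_1(A_{N_i})$ on $V_i$ in which $K_1$ has the simple eigenvalues $\lambda_{k-N_i/2}$ and $L_1$ the simple eigenvalues $\mu_{k-N_i/2}$ ($0\le k\le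 N_i$); the operators $1\otimes K_1$, $L_1\otimes1$, $K_2$, $L_2$, $M_2$ are self-adjoint. Basis: $\psi_{n_2}\in V_2$, $n_2\in\{-\frac{N_2}2,-\frac{N_2}2+1,\dots,\frac{N_2}2\}$, are orthonormal with $K_1\psi_{n_2}=\lambda_{n_2}\psi_{n_2}$; for each $n_2$, $\{\psi_{n_1}^{n_2}\}$ with $n_1\in\{n_2-\frac{N_1}2,\dots,n_2+\frac{N_1}2\}$ is an orthonormal basis of $V_1$ with $K_2(\psi_{n_1}^{n_2}\otimes\psi_{n_2})=\lambda_{n_1}\psi_{n_1}^{n_2}\otimes\psi_{n_2}$. Vectors with indices outside these ranges are read as $0$.
   Formalization: Corrected: a_n, b_n at α_{L1}^{n2} are taken at n = n1−n2 (shifted likewise) instead of n1; ã_n²(β) = −a_n²(β0,−β2,β1,β3); denominators of the occurring a_{n1,n2}, c_{n1,n2} are assumed nonzero; the formula holds after suitable phases of the basis and choices of square roots. *)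

(* Defs.v *)
From HB Require Import structures.
From mathcomp Require Import all_boot all_order all_algebra.
From mathcomp Require Import sesquilinear complex.
From mathcomp Require Import reals exp.

Set Implicit Arguments.
Unset Strict Implicit.
Unset Printing Implicit Defensive.

Import Order.TTheory GRing.Theory Num.Theory.
Local Open Scope ring_scope.
Local Open Scope complex_scope.

Definition sinhq (R : realType) (q x : R) : R := q `^ x - q `^ (- x).
Definition coshq (R : realType) (q x : R) : R := q `^ x + q `^ (- x).

Definition asq (R : realType) (q n : R) (beta : R * R * R * R) : R :=
  let: (b0, b1, b2, b3) := beta in
  - (\prod_(p <- [:: b0 + b3; b0 - b3; b1 + b2; b1 - b2])
       (sinhq q (2 * n + b0 - 1) - sinhq q p))
  / (coshq q (2 * n + b0 - 1) ^+ 2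
     * coshq q (2 * n + b0) * coshq q (2 * n + b0 - 2)).

(* The common shape of b_n and its tilde version, which differ only in the
   meaning of B1 and B2. *)
Definition bform (R : realType) (q n b0 B0 B1 B2 B3 : R) : R :=
  ((B0 * B1 - B2 * B3) * sinhq q (2 * n + b0)
     + coshq q 1 * (B1 * B3 + B0 * B2))
  / (coshq q (2 * n + b0 - 1) * coshq q (2 * n + b0 + 1)).

Definition bcoef (R : realType) (q n : R) (beta : R * R * R * R) : R :=
  let: (b0, b1, b2, b3) := beta in
  bform q n b0 (sinhq q b0) (sinhq q b1) (coshq q b2) (coshq q b3).

(* The sign of b2 makes this vanish at both ends of each M2-ladder (n1 fixed);
   with +b2 the operator M2 would not satisfy its defining relations. *)
Definition tasq (R : realType) (q n : R) (beta : R * R * R * R) : R :=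
  let: (b0, b1, b2, b3) := beta in - asq q n (b0, - b2, b1, b3).

Definition tbcoef (R : realType) (q n : R) (beta : R * R * R * R) : R :=
  let: (b0, b1, b2, b3) := beta in
  bform q n b0 (sinhq q b0) (coshq q b1) (sinhq q b2) (coshq q b3).

(* The product of 'End(V).  The library notation \o has the precedence of
   + and -, hence this one. *)
Local Notation "f ** g" := (comp_lfun f g) (at level 40, left associativity).

Definition AW_rel (R : realType) (q : R) (V : vectType R[i])
    (K L A0 A1 A2 A3 A4 A5 : 'End(V)) : Prop :=
  let s2 := ((sinhq q 1) ^+ 2)%:C in
  let c1 := (coshq q 1)%:C in
  let c2 := (coshq q 2)%:C in
  let B := A0 ** A1 - A2 ** A3 in
  (c2 *: (K ** L ** K) - K ** K ** L - L ** K ** K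
     = s2 *: (B ** K) - c1 ^+ 2 *: (A5 ** L)
       + c1 *: (A1 ** A3 ** A5 + s2 *: (A0 ** A2)))
  /\
  (c2 *: (L ** K ** L) - L ** L ** K - K ** L ** L
     = s2 *: (B ** L) - c1 ^+ 2 *: (A4 ** K)
       + c1 *: (A0 ** A3 ** A4 + s2 *: (A1 ** A2))).

Definition commuting (R : realType) (V : vectType R[i]) (s : seq 'End(V)) :=
  forall f g, f \in s -> g \in s -> f ** g = g ** f.

(* AW(K, L | A0, ..., A5) = 0 with locally central structure parameters. *)
Definition AW (R : realType) (q : R) (V : vectType R[i])
    (K L A0 A1 A2 A3 A4 A5 : 'End(V)) : Prop :=
  [/\ AW_rel q K L A0 A1 A2 A3 A4 A5,
      commuting [:: K; A0; A1; A2; A3; A4; A5] &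
      commuting [:: L; A0; A1; A2; A3; A4; A5]].

Definition scal (R : realType) (V : vectType R[i]) (x : R) : 'End(V) :=
  (x%:C *: \1)%VF.
Arguments scal {R} V x.

Record aw_data (R : realType) := AWData {
  qq : R; al0 : R; al1 : R; al2 : R; N1 : nat; N2 : nat }.

Definition A0c (R : realType) (p : aw_data R) : R := sinhq (qq p) (al0 p).
Definition A1c (R : realType) (p : aw_data R) : R := sinhq (qq p) (al1 p).
Definition A2c (R : realType) (p : aw_data R) : R := coshq (qq p) (al2 p).
Definition ANc (R : realType) (p : aw_data R) (N : nat) : R :=
  coshq (qq p) (- N%:R - 1).
(* The common value of sigma_K and sigma_L in the representation. *)
Definition sigc (R : realType) (p : aw_data R) : R := (sinhq (qq p) 1) ^+ 2.

Definition lam (R : realType) (p : aw_data R) (x : R) : R :=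
  sinhq (qq p) (2 * x + al0 p).
Definition mu (R : realType) (p : aw_data R) (x : R) : R :=
  sinhq (qq p) (2 * x + al1 p).

Definition self_adjoint (R : realType) (V : vectType R[i])
    (dot : {dot V for (@Num.conj R[i])}) (f : 'End(V)) : Prop :=
  forall u v, dot (f u) v = dot u (f v).

(* (W, tens) is the tensor product of V1 and V2 with the product inner
   product: pure tensors span W and, the product form being positive definite,
   tensors of orthonormal bases are linearly independent. *)
Definition is_tensor_product (R : realType) (V1 V2 W : vectType R[i])
    (dot1 : {dot V1 for (@Num.conj R[i])})
    (dot2 : {dot V2 for (@Num.conj R[i])})
    (dotW : {dot W for (@Num.conj R[i])})
    (tens : {bilinear V1 -> V2 -> W}) : Prop :=
  (forall w, exists s : seq (V1 * V2), w = \sum_(x <- s) tens x.1 x.2)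
  /\ (forall u u' v v', dotW (tens u v) (tens u' v') = dot1 u u' * dot2 v v').

Definition is_tensor_op (R : realType) (V1 V2 W : vectType R[i])
    (tens : {bilinear V1 -> V2 -> W}) (f : 'End(V1)) (g : 'End(V2))
    (h : 'End(W)) : Prop :=
  forall u v, h (tens u v) = tens (f u) (g v).

Definition is_AW1_rep (R : realType) (p : aw_data R) (N : nat)
    (V : vectType R[i]) (K1 L1 : 'End(V)) : Prop :=
  [/\ AW (qq p) K1 L1 (scal V (A0c p)) (scal V (A1c p)) (scal V (A2c p))
        (scal V (ANc p N)) (scal V (sigc p)) (scal V (sigc p)),
      forall k : nat, (k <= N)%N ->
        \dim (passmx.leigenspace K1 (lam p (k%:R - N%:R / 2))%:C) = 1%N &
      forall k : nat, (k <= N)%N ->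
        \dim (passmx.leigenspace L1 (mu p (k%:R - N%:R / 2))%:C) = 1%N].

(* Images of the generators of AW2: K1_i, L1_i act on V_i; K1x, L1x, xK1, xL1
   stand for K1 (x) 1, L1 (x) 1, 1 (x) K1, 1 (x) L1 on W. *)
Record aw2_ops (R : realType) (V1 V2 W : vectType R[i]) := AW2Ops {
  K1_1 : 'End(V1); L1_1 : 'End(V1);
  K1_2 : 'End(V2); L1_2 : 'End(V2);
  K1x : 'End(W); L1x : 'End(W); xK1 : 'End(W); xL1 : 'End(W);
  K2 : 'End(W); L2 : 'End(W); M2 : 'End(W) }.

(* An action of an algebra given by generators and relations is a choice of
   operators, one for each generator, satisfying the relations. *)
Record is_AW2_rep (R : realType) (p : aw_data R) (V1 V2 W : vectType R[i])
    (dotW : {dot W for (@Num.conj R[i])}) (tens : {bilinear V1 -> V2 -> W})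
    (T : aw2_ops V1 V2 W) : Prop := IsAW2Rep {
  rep_V1 : is_AW1_rep p (N1 p) (K1_1 T) (L1_1 T);
  rep_V2 : is_AW1_rep p (N2 p) (K1_2 T) (L1_2 T);
  rep_K1x : is_tensor_op tens (K1_1 T) \1%VF (K1x T);
  rep_L1x : is_tensor_op tens (L1_1 T) \1%VF (L1x T);
  rep_xK1 : is_tensor_op tens \1%VF (K1_2 T) (xK1 T);
  rep_xL1 : is_tensor_op tens \1%VF (L1_2 T) (xL1 T);
  rep_K2L2 : AW (qq p) (K2 T) (L2 T)
    (scal W (A0c p)) (scal W (A1c p)) (scal W (A2c p)) (M2 T)
    (scal W (sigc p)) (scal W (sigc p));
  rep_K1L2 : AW (qq p) (xK1 T) (L2 T)
    (scal W (A0c p)) (L1x T) (scal W (A2c p)) (scal W (ANc p (N2 p)))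
    (scal W (sigc p)) (scal W (sigc p));
  rep_K2L1 : AW (qq p) (K2 T) (L1x T)
    (xK1 T) (scal W (A1c p)) (scal W (A2c p)) (scal W (ANc p (N1 p)))
    (scal W (sigc p)) (scal W (sigc p));
  rep_K1M2 : AW (qq p) (xK1 T) (M2 T)
    (scal W (A0c p)) (scal W (ANc p (N1 p))) (- K2 T)
    (scal W (ANc p (N2 p)))
    (scal W (- (sinhq (qq p) 1) ^+ 2)) (scal W (sigc p));
  rep_M2L1 : AW (qq p) (M2 T) (L1x T)
    (scal W (ANc p (N2 p))) (scal W (A1c p)) (- L2 T)
    (scal W (ANc p (N1 p)))
    (scal W (sigc p)) (scal W (- (sinhq (qq p) 1) ^+ 2));
  rep_sa_xK1 : self_adjoint dotW (xK1 T);
  rep_sa_L1x : self_adjoint dotW (L1x T);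
  rep_sa_K2 : self_adjoint dotW (K2 T);
  rep_sa_L2 : self_adjoint dotW (L2 T);
  rep_sa_M2 : self_adjoint dotW (M2 T) }.

Definition range2 (R : realType) (p : aw_data R) (n2 : R) : Prop :=
  exists2 k : nat, (k <= N2 p)%N & n2 = k%:R - (N2 p)%:R / 2.

Definition range12 (R : realType) (p : aw_data R) (n1 n2 : R) : Prop :=
  range2 p n2 /\
  exists2 j : nat, (j <= N1 p)%N & n1 = n2 + j%:R - (N1 p)%:R / 2.

(* psi1 n1 n2 is the vector with lower index n1 and upper index n2.  Each
   orthonormal family has as many members as the dimension of its space. *)
Record is_eigenbasis (R : realType) (p : aw_data R) (V1 V2 W : vectType R[i])
    (dot1 : {dot V1 for (@Num.conj R[i])})
    (dot2 : {dot V2 for (@Num.conj R[i])})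
    (tens : {bilinear V1 -> V2 -> W}) (T : aw2_ops V1 V2 W)
    (psi1 : R -> R -> V1) (psi2 : R -> V2) : Prop := IsEigenbasis {
  psi2_out : forall n2, ~ range2 p n2 -> psi2 n2 = 0;
  psi1_out : forall n1 n2, ~ range12 p n1 n2 -> psi1 n1 n2 = 0;
  psi2_on : forall n2 m2, range2 p n2 -> range2 p m2 ->
    dot2 (psi2 n2) (psi2 m2) = (n2 == m2)%:R;
  psi1_on : forall n1 m1 n2, range12 p n1 n2 -> range12 p m1 n2 ->
    dot1 (psi1 n1 n2) (psi1 m1 n2) = (n1 == m1)%:R;
  psi2_eig : forall n2, range2 p n2 ->
    K1_2 T (psi2 n2) = (lam p n2)%:C *: psi2 n2;
  psi1_eig : forall n1 n2, range12 p n1 n2 ->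
    K2 T (tens (psi1 n1 n2) (psi2 n2))
      = (lam p n1)%:C *: tens (psi1 n1 n2) (psi2 n2) }.

Definition alphaL (R : realType) (p : aw_data R) (n2 : R) : R * R * R * R :=
  (al0 p + 2 * n2, al1 p, al2 p, - (N1 p)%:R - 1).
Definition alphaM (R : realType) (p : aw_data R) (n1 : R) : R * R * R * R :=
  (al0 p, - (N1 p)%:R - 1, - al0 p - 2 * n1, - (N2 p)%:R - 1).

(* A square-root function for asq (or tasq) on all arguments. *)
Definition is_sqrt (R : realType) (f : R -> R * R * R * R -> R)
    (r : R -> R * R * R * R -> R[i]) : Prop :=
  forall n beta, r n beta ^+ 2 = (f n beta)%:C.

(* In the AW1-representation with first parameter alpha0 + 2 n2, the vector
   with K2-eigenvalue lam n1 = sinhq (2 (n1 - n2) + (alpha0 + 2 n2)) sits at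
   position n1 - n2 of the ladder, whose ends are -N1/2 and N1/2. *)
Definition aL (R : realType) (p : aw_data R) (ra : R -> R * R * R * R -> R[i])
    (n1 n2 : R) : R[i] := ra (n1 - n2) (alphaL p n2).
Definition bL (R : realType) (p : aw_data R) (n1 n2 : R) : R :=
  bcoef (qq p) (n1 - n2) (alphaL p n2).

Definition den (R : realType) (p : aw_data R) (n : R) : R :=
  coshq (qq p) (2 * n + al0 p - 1) * coshq (qq p) (2 * n + al0 p + 1).

Definition coef_b (R : realType) (p : aw_data R)
    (ra : R -> R * R * R * R -> R[i]) (n1 n2 : R) : R[i] :=
  aL p ra n1 n2
  * (A0c p * lam p n2 + coshq (qq p) 1 * ANc p (N2 p))%:C / (den p n2)%:C.

Definition coef_d (R : realType) (p : aw_data R)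
    (rta : R -> R * R * R * R -> R[i]) (n1 n2 : R) : R[i] :=
  rta n2 (alphaM p n1)
  * (coshq (qq p) 1 * A1c p - A2c p * lam p n1)%:C / (den p n1)%:C.

Definition coef_e (R : realType) (p : aw_data R) (n1 n2 : R) : R[i] :=
  ((tbcoef (qq p) n2 (alphaM p n1)
      * (coshq (qq p) 1 * A1c p - A2c p * lam p n1)
    + A0c p * (A1c p * lam p n1 + coshq (qq p) 1 * A2c p)) / den p n1)%:C.

Definition den_a (R : realType) (p : aw_data R) (n1 n2 : R) : R :=
  bL p (n1 - 1) (n2 - 1) - bL p n1 n2.
Definition den_c (R : realType) (p : aw_data R) (n1 n2 : R) : R :=
  bL p (n1 - 1) (n2 + 1) - bL p n1 n2.

Definition coef_a (R : realType) (p : aw_data R)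
    (ra rta : R -> R * R * R * R -> R[i]) (n1 n2 : R) : R[i] :=
  (aL p ra n1 n2 * coef_d p rta (n1 - 1) n2
   - aL p ra n1 (n2 - 1) * coef_d p rta n1 n2) / (den_a p n1 n2)%:C.

Definition coef_c (R : realType) (p : aw_data R)
    (ra rta : R -> R * R * R * R -> R[i]) (n1 n2 : R) : R[i] :=
  (aL p ra n1 n2 * coef_d p rta (n1 - 1) (n2 + 1)
   - aL p ra n1 (n2 + 1) * coef_d p rta n1 (n2 + 1)) / (den_c p n1 n2)%:C.

(* Every quotient coef_a, coef_c that multiplies a basis vector in the nine-term
   formula has a nonzero denominator.  This is a genuine restriction: for
   N1 = 0 < N2 these quotients are 0 / 0. *)
Definition coefs_defined (R : realType) (p : aw_data R) : Prop :=
  (forall n1 n2, range12 p n1 n2 -> range12 p (n1 - 1) (n2 - 1) ->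
     den_a p n1 n2 != 0) /\
  (forall n1 n2, range12 p n1 n2 -> range12 p (n1 - 1) (n2 + 1) ->
     den_c p n1 n2 != 0).

(* Main.v *)
(** Write [E i k] for the joint eigenbasis of [1 (x) K1] and [K2]. The first of each
pair of AW relations multiplies the entries of the second generator by
[- (s - sinh_q(x + 2)) (s - sinh_q(x - 2))], so that [L1 (x) 1] moves only the index [i],
by at most one step, [M2] likewise the index [k], and [L2] is a nine-term operator whose
diagonal blocks are affine in [M2] and [L1 (x) 1]; this gives the coefficients b, d, e.
The diagonal entries of the second AW relations are first-order recurrences for the
squared moduli of the lowering entries, solved by the functions a_n^2 and their tilde
versions. The corners a and c follow from [L1 L2 = L2 L1].

It remains to choose phases making all lowering entries real, which is possible if and
only if [P Q^*] is real for every elementary square, where [P] and [Q] are the products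
of the entries along its two paths. The relations [L1 L2 = L2 L1], [M2 L2 = L2 M2] and
the second AW relation of [M2] and [L1] are real linear equations for [P], [Q] and the
corner of [L2]. If [P Q^*] is not real they are all proportional, for both diagonals of
the square, and this forces two distinct values of [(A2 + i A1) / (cosh_q 1 + i s)] to
be real multiples of each other, whereas these values are pairwise independent over the
reals. *)
Require Import Defs.
From HB Require Import structures.
From mathcomp Require Import all_boot all_order all_algebra.
From mathcomp Require Import sesquilinear complex.
From mathcomp Require Import boolp reals exp.
From mathcomp Require Import ring lra zify.

Set Implicit Arguments.
Unset Strict Implicit.
Unset Printing Implicit Defensive.

Import Order.TTheory GRing.Theory Num.Theory.
Local Open Scope ring_scope.
Local Open Scope complex_scope.

(** * q-hyperbolic functions *)

Lemma gtr_powR (R : realType) (a : R) : 0 < a < 1 ->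
  {homo powR a : x y /~ x < y}.
Proof.
case/andP=> a_gt0 a_lt1 x y yx; rewrite /powR gt_eqF // ltr_expR.
by rewrite ltr_nM2r // ln_lt0 // a_gt0.
Qed.

Section QHyperbolic.
Variables (R : realType) (q : R).
Hypothesis q_gt0 : 0 < q.
Implicit Types x y : R.
Local Notation sinh := (sinhq q).
Local Notation cosh := (coshq q).

Let powqD x y : q `^ (x + y) = q `^ x * q `^ y.
Proof. by rewrite powRD // (gt_eqF q_gt0) implybT. Qed.

Local Ltac powq_field x y :=
  rewrite /sinhq /coshq ?mulr2n !powRN ?powqD ?powRN;
  have := powR_gt0 x q_gt0; have := powR_gt0 y q_gt0;
  move: (q `^ x) (q `^ y) => X Y Y_gt0 X_gt0; field; rewrite !gt_eqF.

Lemma sinhq0 : sinh 0 = 0.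
Proof. by rewrite /sinhq oppr0 subrr. Qed.

Lemma sinhqN x : sinh (- x) = - sinh x.
Proof. by rewrite /sinhq opprK opprB. Qed.

Lemma coshqN x : cosh (- x) = cosh x.
Proof. by rewrite /coshq opprK addrC. Qed.

Lemma coshq_gt0 x : 0 < cosh x.
Proof. by rewrite addr_gt0 ?powR_gt0. Qed.

Lemma coshq_neq0 x : cosh x != 0.
Proof. by rewrite gt_eqF ?coshq_gt0. Qed.

Lemma sinhq_addDB x y : sinh (x + y) + sinh (x - y) = sinh x * cosh y.
Proof. by powq_field x y. Qed.

Lemma sinhq_subDB x y : sinh (x + y) - sinh (x - y) = cosh x * sinh y.
Proof. by powq_field x y. Qed.

Lemma sinhq_mulDB x y :
  sinh (x + y) * sinh (x - y) = sinh x ^+ 2 - cosh y ^+ 2 + 4.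
Proof. by powq_field x y. Qed.

Lemma coshq_mulDB x y :
  cosh (x + y) * cosh (x - y) = sinh x ^+ 2 + cosh y ^+ 2.
Proof. by powq_field x y. Qed.

Lemma sqr_coshq x : cosh x ^+ 2 = sinh x ^+ 2 + 4.
Proof. by powq_field x x. Qed.

Lemma sinhqMn2 x : sinh (x *+ 2) = sinh x * cosh x.
Proof. by powq_field x x. Qed.

Lemma coshqMn2 x : cosh (x *+ 2) = sinh x ^+ 2 + 2.
Proof. by powq_field x x. Qed.

Lemma sinhq_decr : q < 1 -> {homo sinh : x y /~ x < y}.
Proof.
move=> q_lt1; have q01 : 0 < q < 1 by rewrite q_gt0.
by move=> x y yx; rewrite ltrB ?gtr_powR ?ltrN2.
Qed.
End QHyperbolic.

#[local] Opaque sinhq coshq.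

Section QHyperbolicTheory.
Variables (R : realType) (q : R).
Hypothesis q_gt0 : 0 < q.
Implicit Types x y : R.
Local Notation sinh := (sinhq q).
Local Notation cosh := (coshq q).

Lemma coshq_mul_sinhqD x y :
  cosh y * sinh (x + y) - 2 * sinh x = sinh y * cosh (x + y).
Proof.
have := sinhq_addDB q_gt0 (x + y) y; have := sinhq_subDB q_gt0 (x + y) y.
by rewrite addrK => sub_eq add_eq; rewrite mulrC -add_eq [RHS]mulrC -sub_eq; ring.
Qed.

(* The quadratic form multiplying a matrix entry of [L] in the first AW relation:
   it factors, and this is what makes [L] tridiagonal. *)
Lemma sinhq_quadratic x y :
  cosh 2 * sinh x * sinh y - sinh x ^+ 2 - sinh y ^+ 2
    + cosh 1 ^+ 2 * sinh 1 ^+ 2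
  = - ((sinh y - sinh (x + 2)) * (sinh y - sinh (x - 2))).
Proof.
transitivity (- (sinh y ^+ 2 - (sinh (x + 2) + sinh (x - 2)) * sinh y
    + sinh (x + 2) * sinh (x - 2))); last ring.
rewrite (sinhq_addDB q_gt0 x 2) (sinhq_mulDB q_gt0 x 2).
by rewrite (sqr_coshq q_gt0 2) (sinhqMn2 q_gt0 1); ring.
Qed.

Hypothesis q_lt1 : q < 1.

Lemma sinhq_inj : injective sinh.
Proof.
move=> x y; case: (ltrgtP x y) => // /(sinhq_decr q_gt0 q_lt1) /[swap] ->;
  by rewrite ltxx.
Qed.

Lemma sinhq_eq x y : (sinh x == sinh y) = (x == y).
Proof. exact: (inj_eq sinhq_inj). Qed.

Lemma sinhq1_neq0 : sinh 1 != 0.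
Proof. by rewrite -(sinhq0 q) sinhq_eq oner_eq0. Qed.
End QHyperbolicTheory.

(** * Matrix entries of an Askey-Wilson pair *)

Definition aw_num (F : comNzRingType) (sg B0 B1 B2 B3 y : F) : F :=
  (y ^+ 2 - B0 * B3 * y + (B0 ^+ 2 - B3 ^+ 2 + 4))
  * (sg * (y ^+ 2 + 4) - B1 * B2 * y + (B1 ^+ 2 - B2 ^+ 2)).

Lemma aw_num_recurrence (F : comNzRingType) (sg B0 B1 B2 B3 a b s c : F) :
  a + b = s * c -> a * b = s ^+ 2 - c ^+ 2 + 4 ->
  let N := aw_num sg B0 B1 B2 B3 in
  let D := s ^+ 2 + c ^+ 2 in
  let B := (B0 * B1 - B2 * B3) * s + c * (B1 * B3 + B0 * B2) in
  c * (N a * (b ^+ 2 + 4) - N b * (a ^+ 2 + 4))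
  = (b - a) * ((B0 * B1 - B2 * B3) * B * D - s * B ^+ 2
     + D ^+ 2 * (c * (sg * (B0 * B3) + B1 * B2) - c ^+ 2 * sg * s)).
Proof.
move=> sum_ab prod_ab N D B; rewrite /N /aw_num.
set F1 := B0 * B3; set F0 := B0 ^+ 2 - B3 ^+ 2 + 4.
set G1 := B1 * B2; set G0 := 4 * sg + (B1 ^+ 2 - B2 ^+ 2).
(* The left side is [b - a] times a symmetric polynomial in [a] and [b]. *)
transitivity ((b - a) * (c * (F0 * G0 * (a + b)
    - (F0 * G1 + F1 * G0) * (a * b - 4)
    - 4 * (G0 + F1 * G1 + sg * F0) * (a + b)
    + (sg * F1 + G1) * ((a * b) ^+ 2 + 4 * ((a + b) ^+ 2 - a * b))
    - sg * (a + b) * ((a * b) ^+ 2 + 4 * ((a + b) ^+ 2 - 2 * (a * b)))))).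
  by rewrite /G0; ring.
by congr (_ * _); rewrite sum_ab prod_ab /F0 /F1 /G0 /G1 /D /B; ring.
Qed.

Section AWCoefficients.
Variables (R : realType) (q : R).
Local Notation sinh := (sinhq q).
Local Notation cosh := (coshq q).

Definition aw_diag (s B0 B1 B2 B3 : R) : R :=
  ((B0 * B1 - B2 * B3) * s + cosh 1 * (B1 * B3 + B0 * B2))
  / (s ^+ 2 + cosh 1 ^+ 2).

Definition aw_offdiag (sg z B0 B1 B2 B3 : R) : R :=
  - aw_num sg B0 B1 B2 B3 (sinh (z - 1))
  / (cosh (z - 1) ^+ 2 * cosh z * cosh (z - 2)).

Hypothesis q_gt0 : 0 < q.

Lemma aw_den_neq0 (s : R) : s ^+ 2 + cosh 1 ^+ 2 != 0.
Proof. by rewrite gt_eqF // ltr_wpDl ?sqr_ge0 ?exprn_gt0 ?coshq_gt0. Qed.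

Lemma bformE n b0 B0 B1 B2 B3 :
  bform q n b0 B0 B1 B2 B3 = aw_diag (sinh (2 * n + b0)) B0 B1 B2 B3.
Proof.
have := coshq_mulDB q_gt0 (2 * n + b0) 1; rewrite [_ * cosh _]mulrC.
by rewrite /bform /aw_diag => ->.
Qed.

Lemma asqE n b0 b1 b2 b3 : asq q n (b0, b1, b2, b3)
  = aw_offdiag 1 (2 * n + b0) (sinh b0) (sinh b1) (cosh b2) (cosh b3).
Proof.
have factor y a b : (y - sinh (a + b)) * (y - sinh (a - b)) =
    y ^+ 2 - sinh a * cosh b * y + (sinh a ^+ 2 - cosh b ^+ 2 + 4).
  by rewrite -(sinhq_addDB q_gt0 a b) -(sinhq_mulDB q_gt0 a b); ring.
rewrite /asq /aw_offdiag /aw_num !big_cons big_nil mulr1 mulrA !factor.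
by congr (- _ / _); ring.
Qed.

Lemma tasqE n b0 b1 b2 b3 : tasq q n (b0, b1, b2, b3)
  = aw_offdiag (-1) (2 * n + b0) (sinh b0) (cosh b1) (sinh b2) (cosh b3).
Proof. by rewrite /tasq asqE sinhqN /aw_offdiag /aw_num; ring. Qed.

Lemma aw_recurrence sg z B0 B1 B2 B3 :
  let s := sinh z in
  let b := aw_diag s B0 B1 B2 B3 in
  let h := fun z => aw_offdiag sg z B0 B1 B2 B3 in
  (cosh 2 * sinh (z - 2) - 2 * s) * h z
  + (cosh 2 * sinh (z + 2) - 2 * s) * h (z + 2)
  + (cosh 2 - 2) * s * b ^+ 2
  = sinh 1 ^+ 2 * (B0 * B1 - B2 * B3) * b
    - cosh 1 ^+ 2 * (sg * sinh 1 ^+ 2) * s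
    + cosh 1 * (B0 * B3 * (sg * sinh 1 ^+ 2) + sinh 1 ^+ 2 * (B1 * B2)).
Proof.
move=> s b h.
have sum_s : sinh (z - 1) + sinh (z + 1) = s * cosh 1.
  by rewrite addrC (sinhq_addDB q_gt0 z 1).
have prod_s : sinh (z - 1) * sinh (z + 1) = s ^+ 2 - cosh 1 ^+ 2 + 4.
  by rewrite mulrC (sinhq_mulDB q_gt0 z 1).
have prod_c : s ^+ 2 + cosh 1 ^+ 2 = cosh (z - 1) * cosh (z + 1).
  by rewrite mulrC (coshq_mulDB q_gt0 z 1).
have step_down : cosh 2 * sinh (z - 2) - 2 * s
    = - (sinh 1 * cosh 1 * cosh (z - 2)).
  by rewrite -(coshqN q 2) coshq_mul_sinhqD // sinhqN mulNr -sinhqMn2.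
have step_up : cosh 2 * sinh (z + 2) - 2 * s = sinh 1 * cosh 1 * cosh (z + 2).
  by rewrite coshq_mul_sinhqD // -sinhqMn2.
have := aw_num_recurrence sg B0 B1 B2 B3 sum_s prod_s.
rewrite /= -!sqr_coshq // (sinhq_subDB q_gt0 z 1) prod_c.
rewrite step_down step_up /h /aw_offdiag /b /aw_diag prod_c addrK.
have -> : z + 2 - 1 = z + 1 by ring.
have -> : cosh 2 = sinh 1 ^+ 2 + 2 by rewrite -coshqMn2.
have := (coshq_neq0 q_gt0 (z - 1), coshq_neq0 q_gt0 (z + 1)).
have := (coshq_neq0 q_gt0 (z - 2), coshq_neq0 q_gt0 (z + 2)).
have := (coshq_neq0 q_gt0 z, coshq_neq0 q_gt0 1).
move: (cosh (z - 1)) (cosh (z + 1)) (cosh z) (cosh (z - 2)) (cosh (z + 2)).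
move: (aw_num _ _ _ _ _ _) (aw_num _ _ _ _ _ _) (cosh 1) (sinh 1) (s).
move=> Np Nm c s1 t Dm Dp D Dmm Dpp [D0 c0] [Dmm0 Dpp0] [Dm0 Dp0] num_rec.
set B := (X in (X / _) ^+ 2).
transitivity (s1 / (D * (Dm * Dp) ^+ 2) * (c * (Nm * Dp ^+ 2 - Np * Dm ^+ 2))
  + s1 ^+ 2 * t * (B / (Dm * Dp)) ^+ 2).
  by field; rewrite D0 Dm0 Dp0 Dmm0 Dpp0.
by rewrite num_rec -/B; field; rewrite D0 Dm0 Dp0.
Qed.

Hypothesis q_lt1 : q < 1.

Lemma aw_step_neq0 z : cosh 2 * sinh (z + 2) - 2 * sinh z != 0.
Proof.
rewrite coshq_mul_sinhqD // mulf_neq0 ?coshq_neq0 //.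
by rewrite -(sinhq0 q) sinhq_eq // pnatr_eq0.
Qed.

Lemma asq_eq0 n b0 b1 b2 b3 : let y := 2 * n + b0 - 1 in
  (asq q n (b0, b1, b2, b3) == 0)
  = [|| y == b0 + b3, y == b0 - b3, y == b1 + b2 | y == b1 - b2].
Proof.
rewrite /= /asq !big_cons big_nil mulr1 mulf_eq0 oppr_eq0 invr_eq0.
rewrite (negPf (_ : cosh _ ^+ 2 * _ * _ != 0)) ?orbF; last first.
  by rewrite !mulf_neq0 ?expf_neq0 ?coshq_neq0.
by rewrite !mulf_eq0 !subr_eq0 !sinhq_eq.
Qed.

Lemma tasq_eq0 n b0 b1 b2 b3 : let y := 2 * n + b0 - 1 in
  (tasq q n (b0, b1, b2, b3) == 0)
  = [|| y == b0 + b3, y == b0 - b3, y == - b2 + b1 | y == - b2 - b1].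
Proof. by rewrite /= /tasq oppr_eq0 asq_eq0. Qed.
End AWCoefficients.

Local Notation "f ** g" := (comp_lfun f g) (at level 40, left associativity).

Lemma eq_of_subr (V : zmodType) (a b c d : V) : a - b = c - d -> c = d -> a = b.
Proof. by move=> sub_eq cd; apply/eqP; rewrite -subr_eq0 sub_eq cd subrr. Qed.

Lemma eq_div_realC (R : realType) (D x : R) (z w : R[i]) : D != 0 ->
  D%:C * z = x%:C * w -> z = (x / D)%:C * w.
Proof.
move=> D0 Dz; rewrite fmorph_div /= mulrAC -Dz mulrAC divff ?mul1r //.
by rewrite fmorph_eq0.
Qed.

Lemma normsq_realC_eq0 (R : realType) (z : R[i]) (x : R) :
  `|z| ^+ 2 = x%:C -> (z == 0) = (x == 0).
Proof. by move=> zx; rewrite -normr_eq0 -sqrf_eq0 zx fmorph_eq0. Qed.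

Lemma conj_realC (R : realType) (x : R) : (x%:C)^*%R = x%:C.
Proof. exact: conjc_real. Qed.

Section HermitianForm.
Variables (R : realType) (W : vectType R[i]) (dot : {dot W for (@Num.conj R[i])}).
Implicit Types (u v w : W) (A K : 'End(W)).

(* Instances of the bilinearity lemmas: with the general ones, [rewrite] leaves the
   scaling laws of the form unsimplified. *)
Lemma dotDl u v w : dot (u + v) w = dot u w + dot v w.
Proof. exact: linearDl. Qed.

Lemma dotDr u v w : dot w (u + v) = dot w u + dot w v.
Proof. exact: linearDr. Qed.

Lemma dotNl u v : dot (- u) v = - dot u v.
Proof. exact: linearNl. Qed.

Lemma dotZl a u v : dot (a *: u) v = a * dot u v.
Proof. exact: linearZl_LR. Qed.

Lemma dotZr a u v : dot u (a *: v) = a^*%R * dot u v.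
Proof. exact: linearZr_LR. Qed.

Lemma dotC u v : dot u v = (dot v u)^*%R.
Proof. by rewrite hermC mul1r. Qed.

Lemma scalE (x : R) v : scal W x v = x%:C *: v.
Proof. by rewrite /scal scale_lfunE id_lfunE. Qed.

Lemma lfunD A u v : A (u + v) = A u + A v.
Proof. exact: linearD. Qed.

Lemma lfunZ A a u : A (a *: u) = a *: A u.
Proof. exact: linearZ. Qed.

Definition dotE := (dotDl, dotNl, dotZl, dotDr, dotZr, conj_realC).
Definition endE :=
  (add_lfunE, opp_lfunE, comp_lfunE, scalE, scale_lfunE, lfunD, lfunZ).

Lemma dot_eigen_distinct K A (a b : R) u v : self_adjoint dot K ->
  K ** A = A ** K -> K u = a%:C *: u -> K v = b%:C *: v -> a != b ->
  dot (A u) v = 0.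
Proof.
move=> saK KA Ku Kv ab.
have : dot (K (A u)) v = dot (A u) (K v) by rewrite saK.
rewrite -comp_lfunE KA comp_lfunE Ku Kv lfunZ !dotE => /eqP.
rewrite -subr_eq0 -mulrBl -rmorphB mulf_eq0 fmorph_eq0 subr_eq0 (negPf ab).
by move/eqP.
Qed.

Definition unit_or_null u := u = 0 \/ dot u u = 1.

Lemma unit_or_null_scale u : unit_or_null u -> dot u u *: u = u.
Proof. by case=> ->; rewrite ?scaler0 ?scale1r. Qed.

Lemma unit_or_null_mul w u : unit_or_null u -> dot w u * dot u u = dot w u.
Proof.
move=> u1; rewrite -[in RHS](unit_or_null_scale u1) dotZr mulrC.
by rewrite [dot u u in LHS]dotC.
Qed.

Lemma orthogonal_expand (I : eqType) (f : I -> W) w (s : seq I) : uniq s ->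
  (forall i j, i != j -> dot (f i) (f j) = 0) ->
  (forall i, unit_or_null (f i)) ->
  (forall v, (forall i, dot v (f i) = 0) -> v = 0) ->
  (forall i, i \notin s -> dot w (f i) = 0) ->
  w = \sum_(i <- s) dot w (f i) *: f i.
Proof.
move=> uniq_s orth unit total out_s.
apply/eqP; rewrite -subr_eq0; apply/eqP/total => i.
rewrite dotDl dotNl linear_sumlz /=; under eq_bigr do rewrite dotZl.
have [i_s|i_s] := boolP (i \in s).
  rewrite (bigD1_seq i) //= unit_or_null_mul // big1 ?addr0 ?subrr // => j ji.
  by rewrite orth ?mulr0.
rewrite out_s // big1_seq ?subrr // => j /= j_s.
by rewrite orth ?mulr0 //; apply: contraNneq i_s => <-.
Qed.
End HermitianForm.

Lemma comm_comp_lfun (F : nzRingType) (V : vectType F) (A B C : 'End(V)) :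
  C ** A = A ** C -> C ** B = B ** C -> C ** (A ** B) = A ** B ** C.
Proof. by move=> CA CB; rewrite comp_lfunA CA -comp_lfunA CB comp_lfunA. Qed.

Lemma AW_comm (R : realType) (q : R) (W : vectType R[i])
    (K L A0 A1 A2 A3 A4 A5 A : 'End(W)) :
  AW q K L A0 A1 A2 A3 A4 A5 -> A \in [:: A0; A1; A2; A3] ->
  K ** A = A ** K /\ L ** A = A ** L.
Proof.
case=> _ commK commL; rewrite !inE => A_in.
by split; [apply: commK | apply: commL]; rewrite !inE ?eqxx //;
  case/or4P: A_in => ->; rewrite !orbT.
Qed.

Section AWEntries.
Variables (R : realType) (q : R) (W : vectType R[i]).
Variable dot : {dot W for (@Num.conj R[i])}.
Variables (K L A0 A1 A2 A3 A4 : 'End(W)).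
Local Notation sinh := (sinhq q).
Local Notation cosh := (coshq q).
Hypotheses (q_gt0 : 0 < q) (saK : self_adjoint dot K).

Lemma AW_rel_entry (x y : R) u v :
  AW_rel q K L A0 A1 A2 A3 A4 (scal W (sinh 1 ^+ 2)) ->
  K u = (sinh x)%:C *: u -> K v = (sinh y)%:C *: v ->
  (- ((sinh y - sinh (x + 2)) * (sinh y - sinh (x - 2))))%:C * dot (L u) v
  = (sinh 1 ^+ 2)%:C * ((sinh x)%:C * dot ((A0 ** A1 - A2 ** A3) u) v
             + (cosh 1)%:C * dot ((A1 ** A3 + A0 ** A2) u) v).
Proof.
move=> [+ _] Ku Kv; rewrite -(sinhq_quadratic q_gt0).
move: (sinh x) (sinh y) (cosh 1) (cosh 2) (sinh 1) Ku Kv => a b c C s Ku Kv.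
move=> /(congr1 (fun f : 'End(W) => dot (f u) v)).
rewrite !(endE, Ku, dotE, saK, Kv) => entry_eq; apply: (eq_of_subr _ entry_eq).
rewrite !(rmorphD, rmorphB, rmorphN, rmorphM, rmorphXn) /=; ring.
Qed.

Hypotheses (q_lt1 : q < 1)
  (awKL : AW q K L A0 A1 A2 A3 A4 (scal W (sinh 1 ^+ 2))).

Lemma AW_eigenspace_entry (x : R) u v :
  K u = (sinh x)%:C *: u -> K v = (sinh x)%:C *: v ->
  (sinh x ^+ 2 + cosh 1 ^+ 2)%:C * dot (L u) v
  = (sinh x)%:C * dot ((A0 ** A1 - A2 ** A3) u) v
    + (cosh 1)%:C * dot ((A1 ** A3 + A0 ** A2) u) v.
Proof.
move=> Ku Kv; case: awKL => /AW_rel_entry/(_ Ku Kv) entry_eq _ _.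
have s0 : (sinh 1 ^+ 2)%:C != 0 :> R[i].
  by rewrite fmorph_eq0 expf_neq0 // sinhq1_neq0.
apply: (mulfI s0); rewrite -entry_eq -(sinhq_quadratic q_gt0).
by rewrite (coshqMn2 q_gt0 1) mulrA -rmorphM; congr (_%:C * _); ring.
Qed.

Lemma AW_tridiag (x y : R) (d : int) u v :
  1 < `|d| -> y = x + 2 * d%:~R ->
  K u = (sinh x)%:C *: u -> K v = (sinh y)%:C *: v -> dot (L u) v = 0.
Proof.
move=> d_far yE Ku Kv.
have ne_shift (e : int) : d != e -> sinh y != sinh (x + 2 * e%:~R).
  move=> de; rewrite sinhq_eq // yE (inj_eq (addrI _)).
  by rewrite (inj_eq (mulfI _)) ?pnatr_eq0 // eqr_int.
have xy : sinh x != sinh y.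
  by rewrite eq_sym; have := ne_shift 0; rewrite mulr0 addr0; apply; lia.
have vanish (A B : 'End(W)) : A \in [:: A0; A1; A2; A3] ->
    B \in [:: A0; A1; A2; A3] -> dot ((A ** B) u) v = 0.
  move=> /(AW_comm awKL)[KA _] /(AW_comm awKL)[KB _].
  exact: (dot_eigen_distinct saK (comm_comp_lfun KA KB) Ku Kv xy).
case: awKL => /AW_rel_entry/(_ Ku Kv) + _ _.
rewrite !(add_lfunE, opp_lfunE, dotDl, dotNl) !vanish ?inE ?eqxx ?orbT //.
rewrite oppr0 !addr0 !mulr0 addr0 mulr0 => /eqP.
rewrite mulf_eq0 fmorph_eq0 oppr_eq0 mulf_eq0 !subr_eq0.
have := ne_shift 1; have := ne_shift (-1); rewrite mulrN1 mulr1.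
by move=> /(_ ltac:(lia))/negPf-> /(_ ltac:(lia))/negPf-> /eqP.
Qed.
End AWEntries.

Section AWLadder.
Variables (R : realType) (q : R) (W : vectType R[i]).
Variable dot : {dot W for (@Num.conj R[i])}.
Variables (K L A0 A1 A2 A3 : 'End(W)) (f : int -> W).
Variables (sg z0 B0 B1 B2 B3 : R).
Local Notation sinh := (sinhq q).
Local Notation cosh := (coshq q).

Definition rung (j : int) : R := 2 * j%:~R + z0.
Local Notation diag j := (aw_diag q (sinh (rung j)) B0 B1 B2 B3).
Local Notation offdiag j := (aw_offdiag q sg (rung j) B0 B1 B2 B3).

Hypotheses (q_gt0 : 0 < q) (q_lt1 : q < 1).
Hypotheses (saK : self_adjoint dot K) (saL : self_adjoint dot L).
Hypothesis awKL :
  AW q K L A0 A1 A2 A3 (scal W (sg * sinh 1 ^+ 2)) (scal W (sinh 1 ^+ 2)).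
Hypothesis Kf : forall j, K (f j) = (sinh (rung j))%:C *: f j.
Hypothesis A0f : forall j, A0 (f j) = B0%:C *: f j.
Hypothesis A1f : forall j, A1 (f j) = B1%:C *: f j.
Hypothesis A2f : forall j, A2 (f j) = B2%:C *: f j.
Hypothesis A3f : forall j, A3 (f j) = B3%:C *: f j.

Lemma rungD1 j : rung (j + 1) = rung j + 2.
Proof. by rewrite /rung intrD; ring. Qed.

Lemma rungB1 j : rung (j - 1) = rung j - 2.
Proof. by rewrite /rung intrB; ring. Qed.

Lemma ladder_diag j :
  dot (L (f j)) (f j) = (diag j)%:C * dot (f j) (f j).
Proof.
apply: eq_div_realC; first exact: aw_den_neq0.
rewrite (AW_eigenspace_entry q_gt0 saK q_lt1 awKL (Kf j) (Kf j)).
rewrite !(endE, A0f, A1f, A2f, A3f, dotE).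
rewrite !(rmorphD, rmorphB, rmorphM) /=; ring.
Qed.

Local Notation low j := (dot (L (f j)) (f (j - 1))).

Hypothesis L_tridiag : forall j, L (f j) = low j *: f (j - 1)
  + dot (L (f j)) (f j) *: f j + dot (L (f j)) (f (j + 1)) *: f (j + 1).

Lemma ladder_form (A : 'End(W)) (c : int -> R) j :
  (forall j, A (f j) = (c j)%:C *: f j) -> dot (f j) (f j) = 1 ->
  dot (A (L (f j))) (L (f j)) = (c (j - 1))%:C * `|low j| ^+ 2
    + (c j * diag j ^+ 2)%:C + (c (j + 1))%:C * `|low (j + 1)| ^+ 2.
Proof.
move=> Af unit_j; rewrite [X in dot (A X)]L_tridiag.
have up : dot (L (f j)) (f (j + 1)) = (low (j + 1))^*%R.
  by rewrite saL dotC addrK.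
rewrite !lfunD !lfunZ !Af !dotE !(dotC dot (f _)) up ladder_diag unit_j mulr1.
rewrite conj_realC !normCK conjCK [(c j * _)%:C]rmorphM rmorphXn /=; ring.
Qed.

Lemma ladder_balance j : dot (f j) (f j) = 1 ->
  (cosh 2 * sinh (rung (j - 1)) - 2 * sinh (rung j))%:C * `|low j| ^+ 2
  + (cosh 2 * sinh (rung (j + 1)) - 2 * sinh (rung j))%:C * `|low (j + 1)| ^+ 2
  + ((cosh 2 - 2) * sinh (rung j) * diag j ^+ 2)%:C
  = (sinh 1 ^+ 2 * (B0 * B1 - B2 * B3) * diag j
    - cosh 1 ^+ 2 * (sg * sinh 1 ^+ 2) * sinh (rung j)
    + cosh 1 * (B0 * B3 * (sg * sinh 1 ^+ 2) + sinh 1 ^+ 2 * (B1 * B2)))%:C.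
Proof.
move=> unit_j; have [[_ rel2] _ _] := awKL.
have AAL A B : A \in [:: A0; A1; A2; A3] -> B \in [:: A0; A1; A2; A3] ->
    A (B (L (f j))) = L (A (B (f j))).
  move=> /(AW_comm awKL)[_ LA] /(AW_comm awKL)[_ LB].
  by rewrite -!comp_lfunE -comm_comp_lfun // comp_lfunA.
have form_id := @ladder_form \1%VF (fun=> 1) j _ unit_j.
have {form_id} := form_id (fun k => etrans (id_lfunE _) (esym (scale1r _))).
rewrite id_lfunE => form_id.
move: rel2 => /(congr1 (fun g : 'End(W) => dot (g (f j)) (f j))).
rewrite !(add_lfunE, opp_lfunE, comp_lfunE, scalE, scale_lfunE) !dotE.
rewrite (AAL A0 A1) ?(AAL A2 A3) ?inE ?eqxx ?orbT //.
rewrite !(endE, Kf, A0f, A1f, A2f, A3f, dotE).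
rewrite (saL (K _)) (saL (L _)) (saK (L _)) Kf dotZr conj_realC (saL (L _)).
rewrite (ladder_form Kf unit_j) form_id ladder_diag unit_j.
move: (`|low j| ^+ 2) (`|low (j + 1)| ^+ 2) (diag j) => P P' b.
move: (sinh (rung j)) (sinh (rung _)) (sinh (rung _)) (sinh 1) (cosh 1) (cosh 2).
move=> s sm sp s1 c1 c2 rel2; apply: (eq_of_subr _ rel2).
rewrite !(rmorphD, rmorphB, rmorphM, rmorphXn) /=; ring.
Qed.

Lemma ladder_step j : dot (f j) (f j) = 1 ->
  `|low j| ^+ 2 = (offdiag j)%:C -> `|low (j + 1)| ^+ 2 = (offdiag (j + 1))%:C.
Proof.
move=> /ladder_balance balance low_j; move: balance.
rewrite -(aw_recurrence q_gt0) low_j rungD1 rungB1 -/(rung j).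
rewrite [in X in _ = X -> _]rmorphD [in X in _ = X -> _]rmorphD => /addIr.
rewrite !rmorphM => /addrI; apply: mulfI.
by rewrite fmorph_eq0 aw_step_neq0.
Qed.

Lemma ladder_normsq lo hi j :
  (forall i, lo <= i <= hi -> dot (f i) (f i) = 1) ->
  f (lo - 1) = 0 -> offdiag lo = 0 -> lo <= j <= hi + 1 ->
  `|low j| ^+ 2 = (offdiag j)%:C.
Proof.
move=> unit_f f_bottom offdiag_bottom /andP[lo_j j_hi].
have [n jE] : exists n : nat, j = lo + n%:Z by exists `|j - lo|%N; lia.
elim: n => [|n IHn] in j lo_j j_hi jE *.
  by rewrite jE addr0 offdiag_bottom f_bottom linear0 normr0 expr0n.
have -> : j = (j - 1) + 1 by rewrite subrK.
by apply: ladder_step; [apply: unit_f | apply: IHn]; lia.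
Qed.
End AWLadder.

(** * Elementary squares *)

Section Nondegeneracy.
Variables (R : realType) (c A1 A2 : R).

(* The real and imaginary parts of [(A2 + i A1) / (c + i s)]. *)
Definition mobius_re (s : R) : R := (A1 * s + c * A2) / (s ^+ 2 + c ^+ 2).
Definition mobius_im (s : R) : R := (c * A1 - A2 * s) / (s ^+ 2 + c ^+ 2).

Hypotheses (c_gt0 : 0 < c) (A2_neq0 : A2 != 0).

Let den_gt0 (s : R) : 0 < s ^+ 2 + c ^+ 2.
Proof. by rewrite ltr_wpDl ?sqr_ge0 ?exprn_gt0. Qed.

Lemma mobius_independent s t : s != t ->
  mobius_re s * mobius_im t - mobius_re t * mobius_im s != 0.
Proof.
move=> st; have -> : mobius_re s * mobius_im t - mobius_re t * mobius_im s
    = c * (A1 ^+ 2 + A2 ^+ 2) * (s - t)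
      / ((s ^+ 2 + c ^+ 2) * (t ^+ 2 + c ^+ 2)).
  by rewrite /mobius_re /mobius_im; field; rewrite !gt_eqF.
have A_gt0 : 0 < A1 ^+ 2 + A2 ^+ 2.
  by rewrite ltr_wpDl ?sqr_ge0 // exprn_even_gt0.
rewrite !mulf_neq0 ?invr_eq0 ?mulf_neq0 ?subr_eq0 ?(gt_eqF (den_gt0 _)) //.
  by rewrite gt_eqF.
by rewrite gt_eqF.
Qed.

(* The hypotheses say that the equations attached to the two diagonals of a square are
   proportional: the first two give [im s0 = +- im s1], and the difference of the other
   two then makes [(re s0, im s0)] and [(re s1, im s1)] linearly dependent. *)
Lemma plaquette_nondegenerate (A0 A3 N C s0 s1 t0 t1 : R) :
  A3 != 0 -> 0 < C -> s0 != s1 -> t0 != t1 ->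
  let re := mobius_re in let im := mobius_im in
  let h s := (A0 * s + c * A3) / (s ^+ 2 + c ^+ 2) in
  let b s t := t * re s + N * im s in
  let p u v := C * b s0 u - b s1 v - b s0 v - (C - 2) * N * im s0 in
  let q u v := C * b s1 v - b s1 u - b s0 u in
  h t1 * im s1 = h t0 * im s0 -> h t0 * im s1 = h t1 * im s0 ->
  p t0 t1 * im s1 + q t0 t1 * im s0 = 0 ->
  p t1 t0 * im s1 + q t1 t0 * im s0 = 0 -> False.
Proof.
move=> A3_neq0 C_gt0 s01 t01 re im h b p q ratio ratio'.
rewrite /p /q /b => diag antidiag.
have h_neq0 : h t1 != 0 \/ h t0 != 0.
  have [/eqP|] := eqVneq (h t1) 0; last by left.
  have [/eqP|] := eqVneq (h t0) 0; last by right.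
  rewrite !mulf_eq0 !invr_eq0 !(gt_eqF (den_gt0 _)) !orbF => /eqP h0 /eqP h1.
  have /eqP : A0 * (t0 - t1) = 0 by lra.
  rewrite mulf_eq0 subr_eq0 (negPf t01) orbF => /eqP A0_eq0.
  have /eqP : c * A3 = 0 by move: h0; rewrite A0_eq0; lra.
  by rewrite mulf_eq0 (gt_eqF c_gt0) (negPf A3_neq0).
have sqr_diff u v : u * im s1 = v * im s0 -> v * im s1 = u * im s0 ->
    u * (im s0 ^+ 2 - im s1 ^+ 2) = 0.
  move=> uv vu; transitivity (u * im s0 * im s0 - u * im s1 * im s1); first ring.
  by rewrite uv -vu; ring.
have /eqP : im s0 ^+ 2 - im s1 ^+ 2 = 0.
  case: h_neq0 => hn0; apply: (mulfI hn0); rewrite mulr0.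
    exact: sqr_diff ratio ratio'.
  exact: sqr_diff ratio' ratio.
rewrite subr_eq0 eqf_sqr => im_eq.
have combined : (im s1 * re s0 - im s0 * re s1) * (C + 1)
    + (im s1 * re s1 - im s0 * re s0) = 0.
  have t01_neq0 : t0 - t1 != 0 by rewrite subr_eq0.
  by apply: (mulIf t01_neq0); rewrite mul0r; lra.
have det := mobius_independent s01; rewrite -/re -/im in det.
case/orP: im_eq => /eqP im_eq; rewrite im_eq in combined det; move: det.
- rewrite -mulrBl => /negP; apply; apply/eqP/(mulfI (lt0r_neq0 C_gt0)).
  by rewrite mulr0 -[RHS]combined; ring.
- move=> /negP; apply; have C2_neq0 : C + 2 != 0 by rewrite gt_eqF // addr_gt0.
  by apply/eqP/(mulfI C2_neq0); rewrite mulr0 -[RHS]combined; ring.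
Qed.
End Nondegeneracy.

Lemma real_combination_eq0 (R : realType) (P Q : R[i]) (x y : R) :
  x%:C * P + y%:C * Q = 0 -> complex.Im (P * Q^*) != 0 -> x = 0 /\ y = 0.
Proof.
case: P Q => [a b] [c d] /= /eqP; rewrite eq_complex /= => /andP[].
rewrite !(mul0r, subr0, addr0) => /eqP re0 /eqP im0 PQ.
have det_neq0 : b * c - a * d != 0.
  by apply: contraNneq PQ => det0; apply/eqP; lra.
split; apply: (mulIf det_neq0); rewrite mul0r.
- transitivity (c * (x * b + y * d) - d * (x * a + y * c)); first ring.
  by rewrite re0 im0; ring.
- transitivity (b * (x * a + y * c) - a * (x * b + y * d)); first ring.
  by rewrite re0 im0; ring.
Qed.

Lemma corner_elim (R : realType) (a P Q : R[i]) (D g g' e0 e1 e2 : R) :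
  D != 0 -> a * D%:C = g'%:C * P - g%:C * Q ->
  e0%:C * a + e1%:C * P + e2%:C * Q = 0 ->
  complex.Im (P * Q^*) != 0 -> e1 * g + e2 * g' = 0.
Proof.
move=> D0 corner_eq linear_eq PQ.
have /real_combination_eq0/(_ PQ)[Peq0 Qeq0] :
    (D * e1 + e0 * g')%:C * P + (D * e2 - e0 * g)%:C * Q = 0.
  rewrite !(rmorphD, rmorphB, rmorphM) /=.
  transitivity (D%:C * (e0%:C * a + e1%:C * P + e2%:C * Q)
     - e0%:C * (a * D%:C - (g'%:C * P - g%:C * Q))); first ring.
  by rewrite corner_eq linear_eq; ring.
apply: (mulfI D0).
transitivity (g * (D * e1 + e0 * g') + g' * (D * e2 - e0 * g)); first ring.
by rewrite Peq0 Qeq0; ring.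
Qed.

Section LatticeFrame.
Variables (R : realType) (W : vectType R[i]) (dot : {dot W for (@Num.conj R[i])}).
Implicit Types (E : int -> int -> W) (A L M X : 'End(W)).

Definition lower1 E A (i k : int) : R[i] := dot (A (E i k)) (E (i - 1) k).
Definition lower2 E A (i k : int) : R[i] := dot (A (E i k)) (E i (k - 1)).

Definition row_col_path E L M i k : R[i] := lower1 E L i k * lower2 E M (i - 1) k.
Definition col_row_path E L M i k : R[i] := lower1 E L i (k - 1) * lower2 E M i k.

Lemma lower1_scale E A (th : int -> int -> R[i]) i k :
  lower1 (fun i k => th i k *: E i k) A i k
  = th i k * (th (i - 1) k)^*%R * lower1 E A i k.
Proof. by rewrite /lower1 lfunZ !dotE mulrA. Qed.

Lemma lower2_scale E A (th : int -> int -> R[i]) i k :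
  lower2 (fun i k => th i k *: E i k) A i k
  = th i k * (th i (k - 1))^*%R * lower2 E A i k.
Proof. by rewrite /lower2 lfunZ !dotE mulrA. Qed.

(* [X] is a nine-term operator whose blocks on the rows and the columns of the lattice
   are multiples of those of [L] and [M], up to diagonal entries. *)
Record lattice_frame E L M X (b be : int -> int -> R) (g h : int -> R) : Prop :=
  LatticeFrame {
  lf_orth : forall i k i' k', (i != i') || (k != k') -> dot (E i k) (E i' k') = 0;
  lf_unit : forall i k, unit_or_null dot (E i k);
  lf_L : forall i k, L (E i k) = lower1 E L i k *: E (i - 1) k
    + (b i k)%:C *: E i k + dot (L (E i k)) (E (i + 1) k) *: E (i + 1) k;
  lf_M : forall i k, M (E i k) = lower2 E M i k *: E i (k - 1)
    + (be i k)%:C *: E i k + dot (M (E i k)) (E i (k + 1)) *: E i (k + 1);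
  lf_far : forall i k i' k', (1 < `|i - i'|) || (1 < `|k - k'|) ->
    dot (X (E i k)) (E i' k') = 0;
  lf_row : forall i i' k, i != i' ->
    dot (X (E i k)) (E i' k) = (h k)%:C * dot (L (E i k)) (E i' k);
  lf_col : forall i k k', k != k' ->
    dot (X (E i k)) (E i k') = (g i)%:C * dot (M (E i k)) (E i k') }.

Lemma frame_transpose E L M X b be g h : lattice_frame E L M X b be g h ->
  lattice_frame (fun k i => E i k) M L X (fun k i => be i k) (fun k i => b i k) h g.
Proof.
case=> orth unit LE ME far row col.
split=> [k i k' i' ne|k i|k i|k i|k i k' i' ne|k k' i|k i i'].
- by apply: orth; rewrite orbC.
- exact: unit.
- exact: ME.
- exact: LE.
- by apply: far; rewrite orbC.
- exact: col.
- exact: row.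
Qed.

(* The antidiagonal of a square is the diagonal of its reflection. *)
Lemma frame_reflect E L M X b be g h : lattice_frame E L M X b be g h ->
  lattice_frame (fun i k => E i (- k)) L M X (fun i k => b i (- k))
    (fun i k => be i (- k)) g (fun k => h (- k)).
Proof.
case=> orth unit LE ME far row col.
split=> [i k i' k' ne|i k|i k|i k|i k i' k' ne|i i' k|i k k' ne].
- by apply: orth; rewrite eqr_opp.
- exact: unit.
- exact: LE.
- by rewrite [LHS]ME /lower2 !opprD opprK addrC addrA addrAC.
- by apply: far; lia.
- exact: row.
- by apply: col; rewrite eqr_opp.
Qed.

Section Rows.
Variables (E : int -> int -> W) (L M X : 'End(W)).
Variables (b be : int -> int -> R) (g h : int -> R).
Hypotheses (saL : self_adjoint dot L) (hF : lattice_frame E L M X b be g h).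

Definition preserves_rows A := forall i k i' k',
  k != k' -> dot (A (E i k)) (E i' k') = 0.

Lemma frame_dot_L w i k : dot (L w) (E i k)
  = dot (L (E (i - 1) k)) (E i k) * dot w (E (i - 1) k)
    + (b i k)%:C * dot w (E i k) + lower1 E L (i + 1) k * dot w (E (i + 1) k).
Proof.
rewrite saL (lf_L hF) !dotE /lower1 addrK (saL (E (i - 1) k)) (saL (E (i + 1) k)).
by rewrite -!(dotC dot (E _ _)).
Qed.

Lemma frame_L_rows : preserves_rows L.
Proof.
by move=> i k i' k' kk; rewrite (lf_L hF) !dotE !(lf_orth hF) ?kk ?orbT // !mulr0 !addr0.
Qed.

Lemma frame_LL_rows : preserves_rows (L ** L).
Proof.
move=> i k i' k' kk; rewrite comp_lfunE frame_dot_L.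
by rewrite !(frame_L_rows _ _ kk) !mulr0 !addr0.
Qed.

Lemma frame_L_far i k i' : 1 < `|i - i'| -> dot (L (E i k)) (E i' k) = 0.
Proof.
move=> far; rewrite (lf_L hF) !dotE.
by rewrite !(lf_orth hF) ?mulr0 ?addr0 //; lia.
Qed.

Lemma frame_L_diag i k : dot (L (E i k)) (E i k) = (b i k)%:C * dot (E i k) (E i k).
Proof.
rewrite (lf_L hF) !dotE (lf_orth hF (i := i - 1)); last by apply/orP; left; lia.
rewrite (lf_orth hF (i := i + 1)); last by apply/orP; left; lia.
by rewrite !mulr0 addr0 add0r.
Qed.

Lemma lower1_LL i k :
  lower1 E (L ** L) i k = (b i k + b (i - 1) k)%:C * lower1 E L i k.
Proof.
rewrite {1}/lower1 comp_lfunE [X in dot (L X)](lf_L hF) !(endE, dotE).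
rewrite frame_L_diag mulrCA unit_or_null_mul; last exact: (lf_unit hF).
by rewrite (@frame_L_far (i + 1)) ?mulr0 ?addr0 -?mulrDl -?rmorphD 1?addrC //=; lia.
Qed.

Lemma dot_rows_lower2 A i k i' : preserves_rows A ->
  dot (A (M (E i k))) (E i' (k - 1))
  = lower2 E M i k * dot (A (E i (k - 1))) (E i' (k - 1)).
Proof.
move=> A_rows; rewrite (lf_M hF) !(endE, dotE).
by rewrite !(A_rows _ k) ?(A_rows _ (k + 1)) ?mulr0 ?addr0 //; lia.
Qed.

Local Notation P := (row_col_path E L M).
Local Notation Q := (col_row_path E L M).
Local Notation corner i k := (dot (X (E i k)) (E (i - 1) (k - 1))).

Lemma dot_XL i k : dot (X (L (E i k))) (E (i - 1) (k - 1))
  = (g (i - 1))%:C * P i k + (b i k)%:C * corner i k.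
Proof.
rewrite (lf_L hF) !(endE, dotE) (lf_col hF); last lia.
by rewrite [dot (X (E (i + 1) k)) _](lf_far hF) ?mulr0 ?addr0 1?mulrCA //; lia.
Qed.

Lemma dot_LX i k : dot (L (X (E i k))) (E (i - 1) (k - 1))
  = (g i)%:C * Q i k + (b (i - 1) (k - 1))%:C * corner i k.
Proof.
rewrite frame_dot_L [dot (X _) (E (i - 1 - 1) _)](lf_far hF) ?subrK; last lia.
by rewrite (lf_col hF) ?mulr0 ?add0r 1?addrC 1?mulrCA //; lia.
Qed.

Lemma frame_corner i k : L ** X = X ** L ->
  corner i k * (b (i - 1) (k - 1) - b i k)%:C
  = (g (i - 1))%:C * P i k - (g i)%:C * Q i k.
Proof.
move=> /(congr1 (fun f : 'End(W) => dot (f (E i k)) (E (i - 1) (k - 1)))).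
rewrite !comp_lfunE dot_XL dot_LX rmorphB /= => LX_XL.
by apply: (eq_of_subr _ LX_XL); ring.
Qed.

Lemma dot_LML i k : dot (L (M (L (E i k)))) (E (i - 1) (k - 1))
  = (b (i - 1) (k - 1))%:C * P i k + (b i k)%:C * Q i k.
Proof.
rewrite [X in L (M X)](lf_L hF) !(endE, dotE) !(dot_rows_lower2 _ _ _ frame_L_rows).
rewrite (frame_L_far (i := i + 1)) ?frame_L_diag; last lia.
rewrite [lower2 _ _ _ _ * (_ * _)]mulrCA unit_or_null_mul; last exact: (lf_unit hF).
rewrite -/(lower1 E L i (k - 1)) /row_col_path /col_row_path; ring.
Qed.

Lemma dot_LLM i k : dot (L (L (M (E i k)))) (E (i - 1) (k - 1))
  = (b i (k - 1) + b (i - 1) (k - 1))%:C * Q i k.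
Proof.
rewrite -comp_lfunE (dot_rows_lower2 _ _ _ frame_LL_rows).
by rewrite -/(lower1 E (L ** L) i (k - 1)) lower1_LL /col_row_path; ring.
Qed.
End Rows.

Section Plaquette.
Variables (E : int -> int -> W) (L M X : 'End(W)).
Variables (b be : int -> int -> R) (g h : int -> R).
Hypotheses (saL : self_adjoint dot L) (saM : self_adjoint dot M).
Hypothesis hF : lattice_frame E L M X b be g h.
Local Notation P := (row_col_path E L M).
Local Notation Q := (col_row_path E L M).
Local Notation corner i k := (dot (X (E i k)) (E (i - 1) (k - 1))).

Lemma frame_corner_transpose i k : M ** X = X ** M ->
  corner i k * (be (i - 1) (k - 1) - be i k)%:C
  = (h (k - 1))%:C * Q i k - (h k)%:C * P i k.
Proof.
move=> /(frame_corner saM (frame_transpose hF) k i) ->.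
rewrite /row_col_path /col_row_path /lower1 /lower2.
by congr (_ * _ - _ * _); rewrite mulrC.
Qed.

Lemma dot_MLL i k : dot (M (L (L (E i k)))) (E (i - 1) (k - 1))
  = (b i k + b (i - 1) k)%:C * P i k.
Proof.
rewrite (frame_dot_L saM (frame_transpose hF)) -!(comp_lfunE L L).
have rows j (kj : k != j) := frame_LL_rows saL hF i (i - 1) kj.
rewrite (rows (k - 1 - 1)) ?(rows (k - 1)) ?subrK; try lia.
rewrite -/(lower1 E (L ** L) i k) (lower1_LL hF) /row_col_path /lower1 /lower2; ring.
Qed.

Variables (q A1 N AN2 : R) (A5 : 'End(W)).

Lemma plaquette_AW_entry i k :
  AW_rel q M L (scal W AN2) (scal W A1) (- X) (scal W N)
    (scal W (sinhq q 1 ^+ 2)) A5 ->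
  (coshq q 2)%:C * ((b (i - 1) (k - 1))%:C * P i k + (b i k)%:C * Q i k)
  - (b i (k - 1) + b (i - 1) (k - 1))%:C * Q i k - (b i k + b (i - 1) k)%:C * P i k
  = (sinhq q 1 ^+ 2 * N)%:C * ((g (i - 1))%:C * P i k + (b i k)%:C * corner i k)
    - (coshq q 1 * sinhq q 1 ^+ 2 * A1)%:C * corner i k.
Proof.
move=> [_ /(congr1 (fun f : 'End(W) => dot (f (E i k)) (E (i - 1) (k - 1))))].
rewrite !(add_lfunE, opp_lfunE, comp_lfunE, scalE, scale_lfunE) !dotE.
rewrite (dot_LML hF) (dot_LLM saL hF) dot_MLL !lfunZ !dotE (dot_XL hF).
rewrite (frame_L_rows hF); last lia.
rewrite (frame_L_rows (frame_transpose hF)); last lia.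
rewrite (lf_orth hF); last by apply/orP; left; lia.
move=> rel; apply: (eq_of_subr _ rel).
move: (coshq q 1) (coshq q 2) (sinhq q 1 ^+ 2) => c1 c2 s2.
rewrite !rmorphM /=; ring.
Qed.

Lemma plaquette_proportional i k : 0 < q -> L ** X = X ** L -> M ** X = X ** M ->
  AW_rel q M L (scal W AN2) (scal W A1) (- X) (scal W N)
    (scal W (sinhq q 1 ^+ 2)) A5 ->
  b (i - 1) (k - 1) - b i k != 0 -> complex.Im (P i k * (Q i k)^*) != 0 ->
  let C := coshq q 2 in
  h k * g i = h (k - 1) * g (i - 1) /\
  (C * b (i - 1) (k - 1) - b i k - b (i - 1) k - (C - 2) * N * g (i - 1)) * g i
  + (C * b i k - b i (k - 1) - b (i - 1) (k - 1)) * g (i - 1) = 0.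
Proof.
move=> q_gt0 LX MX awML den PQ C; have corner_L := frame_corner saL hF i k LX.
have sinh1 : sinhq q 1 ^+ 2 = C - 2 by rewrite /C (coshqMn2 q_gt0 1) addrK.
split.
- apply/eqP; rewrite -subr_eq0; apply/eqP; rewrite -mulNr.
  apply: (corner_elim den corner_L _ PQ (e0 := be (i - 1) (k - 1) - be i k)).
  apply: (eq_of_subr _ (frame_corner_transpose i k MX)).
  by rewrite rmorphN /=; ring.
- apply: (corner_elim den corner_L _ PQ
    (e0 := coshq q 1 * (C - 2) * A1 - (C - 2) * N * b i k)).
  apply: (eq_of_subr _ (plaquette_AW_entry i k awML)); rewrite sinh1.
  move: (b _ _) (b _ _) (b _ _) (b _ _) (g (i - 1)) (coshq q 1) => b1 b2 b3 b4 g1 c1.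
  by rewrite !(rmorphB, rmorphD, rmorphM) /=; ring.
Qed.
End Plaquette.

Lemma frame_anticorner E L M X b be g h i k :
  self_adjoint dot L -> self_adjoint dot M -> lattice_frame E L M X b be g h ->
  L ** X = X ** L ->
  dot (X (E i k)) (E (i - 1) (k + 1)) * (b (i - 1) (k + 1) - b i k)%:C
  = (g (i - 1))%:C * (lower1 E L i k * (lower2 E M (i - 1) (k + 1))^*%R)
    - (g i)%:C * (lower1 E L i (k + 1) * (lower2 E M i (k + 1))^*%R).
Proof.
move=> saL saM hF /(frame_corner saL (frame_reflect hF) i (- k)).
rewrite /row_col_path /col_row_path /lower1 /lower2 !opprD !opprK addrK => ->.
by rewrite !(saM (E _ k)) -!dotC.
Qed.

Lemma path_reflect E L M i k : self_adjoint dot M ->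
  let E' i k := E i (- k) in
  row_col_path E' L M i (1 - k) * (col_row_path E' L M i (1 - k))^*%R
  = (row_col_path E L M i k * (col_row_path E L M i k)^*%R)^*%R.
Proof.
move=> saM; rewrite /row_col_path /col_row_path /lower1 /lower2 /=.
have [-> ->] : - (1 - k) = k - 1 /\ - (1 - k - 1) = k by split; lia.
rewrite (saM (E i (k - 1))) (saM (E (i - 1) (k - 1))).
rewrite [dot _ (M (E (i - 1) k))]dotC [dot _ (M (E i k))]dotC.
by rewrite !rmorphM /= !conjCK; ring.
Qed.

Lemma plaquette_proportional_reflect E L M X b be g h (q A1 N AN2 : R) A5 i k :
  self_adjoint dot L -> self_adjoint dot M -> lattice_frame E L M X b be g h ->
  0 < q -> L ** X = X ** L -> M ** X = X ** M ->
  AW_rel q M L (scal W AN2) (scal W A1) (- X) (scal W N)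
    (scal W (sinhq q 1 ^+ 2)) A5 ->
  b (i - 1) k - b i (k - 1) != 0 ->
  complex.Im (row_col_path E L M i k * (col_row_path E L M i k)^*) != 0 ->
  let C := coshq q 2 in
  h (k - 1) * g i = h k * g (i - 1) /\
  (C * b (i - 1) k - b i (k - 1) - b (i - 1) (k - 1) - (C - 2) * N * g (i - 1)) * g i
  + (C * b i (k - 1) - b i k - b (i - 1) k) * g (i - 1) = 0.
Proof.
move=> saL saM hF q_gt0 LX MX awML den PQ.
have [kE kE'] : - (1 - k) = k - 1 /\ - (1 - k - 1) = k by split; lia.
have := plaquette_proportional saL saM (frame_reflect hF) q_gt0 LX MX awML
  (i := i) (k := 1 - k).
rewrite kE kE'; apply=> //; rewrite path_reflect //.
by move: PQ; case: (_ * _) => x y /=; rewrite oppr_eq0.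
Qed.
End LatticeFrame.

(** * Phases *)

Section Phases.
Variable R : realType.
Implicit Types z w : R[i].

Definition conj_phase z : R[i] := if z == 0 then 1 else z^*%R / `|z|.

Lemma norm_conj_phase z : `|conj_phase z| = 1.
Proof.
rewrite /conj_phase; case: eqVneq => [_|z0]; first by rewrite normr1.
by rewrite normf_div norm_conjC normr_id divff // normr_eq0.
Qed.

Lemma conj_phase_mul z : conj_phase z * z = `|z|.
Proof.
rewrite /conj_phase; case: eqVneq => [->|z0]; first by rewrite mulr0 normr0.
by rewrite mulrAC [z^*%R * z]mulrC -normCK expr2 mulfK // normr_eq0.
Qed.

Lemma unit_mul_conj z : `|z| = 1 -> z * z^*%R = 1.
Proof. by move=> z1; rewrite -normCK z1 expr1n. Qed.

Lemma conj_phase_flux (x y z z' : R[i]) : z != 0 -> z' != 0 ->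
  conj_phase z * (conj_phase z')^*%R * (x * y^*%R)
  = x * z' * (y * z)^*%R / (`|z| * `|z'|).
Proof.
move=> z0 z'0; have := normr_eq0 z; have := normr_eq0 z'.
rewrite /conj_phase (negPf z0) (negPf z'0) !rmorphM fmorphV /= conjCK.
rewrite (conj_Creal (normr_real _)); move: `|z| `|z'| => n n' n'0 n0.
by field; rewrite n0 n'0.
Qed.

Lemma phase_potential (f : int -> R[i]) : (forall k, `|f k| = 1) ->
  exists g : int -> R[i], (forall k, `|g k| = 1) /\
    forall k, g k * (g (k - 1))^*%R = f k.
Proof.
move=> f1; pose g (k : int) : R[i] := match k with
  | Posz n => \prod_(j < n) f j.+1
  | Negz n => \prod_(j < n.+1) (f (- j%:Z))^*%R
  end.
have g1 k : `|g k| = 1.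
  by case: k => n; rewrite normr_prod big1 // => j _; rewrite ?norm_conjC.
exists g; split=> // -[[|n]|n].
- by rewrite /g /= big_ord0 big_ord1 conjCK mul1r.
- have -> : n.+1%:Z - 1 = n by lia.
  rewrite {1}/g big_ord_recr /= mulrAC unit_mul_conj ?mul1r //.
  exact: g1 (Posz n).
- have -> : Negz n - 1 = Negz n.+1 by lia.
  rewrite {2}/g big_ord_recr /= rmorphM /= conjCK mulrA unit_mul_conj ?mul1r //.
  exact: g1 (Negz n).
Qed.

Lemma common_phase (I : Type) (l : I -> R[i]) :
  (forall i j, l i * (l j)^*%R \is Num.real) ->
  exists r : R[i], `|r| = 1 /\ forall i, r * l i \is Num.real.
Proof.
move=> l_real; case: (pselect (exists i, l i != 0)) => [[i l_i]|l_eq0].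
  exists (conj_phase (l i)); split=> [|j]; first exact: norm_conj_phase.
  rewrite /conj_phase (negPf l_i) mulrAC [_^* * _]mulrC.
  by rewrite rpred_div ?l_real ?normr_real.
exists 1; split=> [|i]; first by rewrite normr1.
have [->|l_i] := eqVneq (l i) 0; first by rewrite mulr0 real0.
by case: l_eq0; exists i.
Qed.

Lemma real_mul_conj_trans w z z' : z != 0 ->
  w * z^*%R \is Num.real -> z * z'^*%R \is Num.real -> w * z'^*%R \is Num.real.
Proof.
move=> z0 wz zz'; have -> : w * z'^*%R = (w * z^*%R) * (z * z'^*%R) / `|z| ^+ 2.
  by rewrite normCK; field; rewrite conjC_eq0 z0.
by apply: rpred_div; [apply: realM | rewrite rpredX ?normr_real].
Qed.

Lemma interval_real_mul_conj (l : int -> R[i]) :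
  (forall j k, j < k -> l j != 0 -> l k != 0 -> l (k - 1) != 0) ->
  (forall k, l k != 0 -> l (k - 1) != 0 -> l k * (l (k - 1))^*%R \is Num.real) ->
  forall j k, l j * (l k)^*%R \is Num.real.
Proof.
move=> l_interval l_adjacent j k; wlog kj : j k / k <= j => [wlog_le|].
  have [|/ltW/wlog_le kj_real] := lerP k j; first exact: wlog_le.
  suff -> : l j * (l k)^*%R = l k * (l j)^*%R by [].
  by rewrite -[RHS](conj_Creal kj_real) rmorphM /= conjCK mulrC.
have [n jE] : exists n : nat, j = k + n%:Z by exists `|j - k|%N; lia.
elim: n => [|n IHn] in j kj jE *.
  by rewrite jE addr0 -normCK rpredX ?normr_real.
have [->|l_j] := eqVneq (l j) 0; first by rewrite mul0r real0.
have [->|l_k] := eqVneq (l k) 0; first by rewrite conjC0 mulr0 real0.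
have l_j1 : l (j - 1) != 0 by apply: (l_interval k) => //; lia.
apply: (real_mul_conj_trans l_j1); first exact: l_adjacent.
by apply: IHn; lia.
Qed.

(* The phases are chosen along each column first, making the [m] nonnegative; the flux
   condition then leaves one phase per row. *)
Lemma lattice_gauge (l m : int -> int -> R[i]) :
  (forall i j k, j < k -> l i j != 0 -> l i k != 0 -> l i (k - 1) != 0) ->
  (forall i k, l i k != 0 -> l i (k - 1) != 0 -> [/\ m i k != 0, m (i - 1) k != 0 &
    l i k * m (i - 1) k * (l i (k - 1) * m i k)^*%R \is Num.real]) ->
  exists th : int -> int -> R[i], [/\ forall i k, `|th i k| = 1,
    forall i k, th i k * (th (i - 1) k)^*%R * l i k \is Num.real &
    forall i k, th i k * (th i (k - 1))^*%R * m i k \is Num.real].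
Proof.
move=> l_interval flux.
have [c cP] := choice (fun i => phase_potential (fun k => norm_conj_phase (m i k))).
pose l' i k := c i k * (c (i - 1) k)^*%R * l i k.
have c_neq0 i k : c i k != 0 by rewrite -normr_eq0 (cP i).1 oner_eq0.
have l'_eq0 i k : (l' i k == 0) = (l i k == 0).
  by rewrite /l' !mulf_eq0 conjC_eq0 !(negPf (c_neq0 _ _)).
have l'_real i j k : l' i j * (l' i k)^*%R \is Num.real.
  apply: interval_real_mul_conj => [{}j {}k|{}k]; rewrite !l'_eq0.
    exact: l_interval.
  move=> l_k l_k1; have [m_ik m_i1k] := flux i k l_k l_k1.
  move=> flux_real; have -> : l' i k * (l' i (k - 1))^*%R
      = (c i k * (c i (k - 1))^*%R) * (c (i - 1) k * (c (i - 1) (k - 1))^*%R)^*%R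
        * (l i k * (l i (k - 1))^*%R) by rewrite /l' !rmorphM /= !conjCK; ring.
  rewrite (cP i).2 (cP (i - 1)).2 conj_phase_flux //.
  by apply: rpred_div => //; apply: realM; apply: normr_real.
have [r rP] := choice (fun i => common_phase (l'_real i)).
have [rho [rho1 rhoE]] := phase_potential (fun i => (rP i).1).
exists (fun i k => rho i * c i k); split=> i k.
- by rewrite normrM rho1 (cP i).1 mulr1.
- have -> : rho i * c i k * (rho (i - 1) * c (i - 1) k)^*%R * l i k
      = rho i * (rho (i - 1))^*%R * l' i k by rewrite /l' rmorphM /=; ring.
  by rewrite rhoE; exact: (rP i).2.
- have -> : rho i * c i k * (rho i * c i (k - 1))^*%R * m i k
      = rho i * (rho i)^*%R * (c i k * (c i (k - 1))^*%R * m i k).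
    by rewrite rmorphM /=; ring.
  by rewrite unit_mul_conj // mul1r (cP i).2 conj_phase_mul normr_real.
Qed.
End Phases.

Lemma choice_extend (I T X : Type) (P : T -> X -> Prop) (D : I -> Prop)
    (x : I -> T) (z : I -> X) : injective x ->
  (forall t, exists y, P t y) -> (forall i, D i -> P (x i) (z i)) ->
  exists f : T -> X, (forall t, P t (f t)) /\ forall i, D i -> f (x i) = z i.
Proof.
move=> x_inj P_total P_z.
have f_exists t : exists y, P t y /\ forall i, D i -> x i = t -> y = z i.
  case: (pselect (exists2 i, D i & x i = t)) => [[i D_i <-]|not_x].
    by exists (z i); split=> [|j _ /x_inj -> //]; apply: P_z.
  have [y P_y] := P_total t; exists y; split=> // i D_i xi.
  by case: not_x; exists i.
have [f fP] := choice f_exists; exists f; split=> [t|i D_i]; first exact: (fP t).1.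
exact: (fP (x i)).2.
Qed.

Lemma sqrt_extend (R : realType) (I : Type) (f : R -> R * R * R * R -> R)
    (D : I -> Prop) (x : I -> R * (R * R * R * R)) (z : I -> R[i]) :
  injective x -> (forall i, D i -> z i ^+ 2 = (f (x i).1 (x i).2)%:C) ->
  exists r, is_sqrt f r /\ forall i, D i -> r (x i).1 (x i).2 = z i.
Proof.
move=> x_inj z_sqrt.
have [|r [r_sqrt rE]] := choice_extend (P := fun t y => y ^+ 2 = (f t.1 t.2)%:C)
    x_inj _ z_sqrt.
  by move=> t; exists (sqrtC (f t.1 t.2)%:C); rewrite sqrtCK.
exists (fun n beta => r (n, beta)); split=> [n beta|i D_i]; first exact: r_sqrt (n, beta).
by rewrite -surjective_pairing rE.
Qed.

(** * The lattice of joint eigenvectors *)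

Section Indices.
Variables (R : realType) (p : aw_data R).

(* The lattice point [(i, k)] carries the indices [n1 = idx1 i] and [n2 = idx2 k]. *)
Definition idx1 (i : int) : R := i%:~R - (N1 p + N2 p)%:R / 2.
Definition idx2 (k : int) : R := k%:~R - (N2 p)%:R / 2.
Definition inrange (i k : int) : bool :=
  (0 <= k <= (N2 p)%:Z) && (k <= i <= k + (N1 p)%:Z).

Lemma idx1_inj : injective idx1.
Proof. by move=> i j /addIr/eqP; rewrite eqr_int => /eqP. Qed.

Lemma idx2_inj : injective idx2.
Proof. by move=> i j /addIr/eqP; rewrite eqr_int => /eqP. Qed.

Lemma idx1D1 i : idx1 (i + 1) = idx1 i + 1.
Proof. by rewrite /idx1 intrD addrAC. Qed.

Lemma idx1B1 i : idx1 (i - 1) = idx1 i - 1.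
Proof. by rewrite /idx1 intrB addrAC. Qed.

Lemma idx2D1 k : idx2 (k + 1) = idx2 k + 1.
Proof. by rewrite /idx2 intrD addrAC. Qed.

Lemma idx2B1 k : idx2 (k - 1) = idx2 k - 1.
Proof. by rewrite /idx2 intrB addrAC. Qed.

Lemma range12_idxP i k : range12 p (idx1 i) (idx2 k) <-> inrange i k.
Proof.
split=> [[[k' k'N kE] [j jN iE]]|ik].
  have {}kE : k = k'%:Z by apply: idx2_inj; rewrite kE /idx2 -pmulrn.
  have -> : i = k + j%:Z.
    by apply: idx1_inj; rewrite iE /idx1 /idx2 natrD intrD -pmulrn; field.
  by rewrite /inrange kE; lia.
have natE (j : int) : 0 <= j -> `|j|%N%:R = j%:~R :> R.
  by move=> j_ge0; rewrite pmulrn; congr (_%:~R); lia.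
move: ik; rewrite /inrange => ik; split.
  by exists `|k|%N; rewrite ?natE //; lia.
exists `|i - k|%N; first lia.
by rewrite natE ?intrB ?/idx1 ?/idx2 ?natrD; [field | lia].
Qed.

Lemma range12_idx n1 n2 : range12 p n1 n2 ->
  exists i k, n1 = idx1 i /\ n2 = idx2 k.
Proof.
move=> [[k _ ->] [j _ ->]]; exists (k%:Z + j%:Z), k%:Z.
by rewrite /idx1 /idx2 intrD natrD -!pmulrn; split=> //; field.
Qed.

Definition row_base : R := al0 p - (N1 p + N2 p)%:R.
Definition col_base : R := al0 p - (N2 p)%:R.

Lemma lam_idx1 i : lam p (idx1 i) = sinhq (qq p) (rung row_base i).
Proof. by rewrite /lam; congr (sinhq _ _); rewrite /rung /row_base /idx1; field. Qed.

Lemma lam_idx2 k : lam p (idx2 k) = sinhq (qq p) (rung col_base k).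
Proof. by rewrite /lam; congr (sinhq _ _); rewrite /rung /col_base /idx2; field. Qed.
End Indices.

Section CoefficientFunctions.
Variables (R : realType) (p : aw_data R).
Local Notation q := (qq p).
Hypothesis q01 : 0 < q < 1.

Let q_gt0 : 0 < q. Proof. by case/andP: q01. Qed.
Let q_lt1 : q < 1. Proof. by case/andP: q01. Qed.

Local Notation la i := (lam p (idx1 p i)).
Local Notation ka k := (lam p (idx2 p k)).

Lemma bL_aw_diag n1 n2 : bL p n1 n2
  = aw_diag q (lam p n1) (lam p n2) (A1c p) (A2c p) (ANc p (N1 p)).
Proof.
rewrite /bL /bcoef /alphaL bformE // /lam.
have -> : 2 * (n1 - n2) + (al0 p + 2 * n2) = 2 * n1 + al0 p by ring.
by rewrite [al0 p + _]addrC.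
Qed.

Lemma tbcoef_aw_diag n1 n2 : tbcoef q n2 (alphaM p n1)
  = aw_diag q (lam p n2) (A0c p) (ANc p (N1 p)) (- lam p n1) (ANc p (N2 p)).
Proof.
rewrite /tbcoef /alphaM bformE // /lam.
have -> : - al0 p - 2 * n1 = - (2 * n1 + al0 p) by ring.
by rewrite sinhqN.
Qed.

Lemma denE n : den p n = lam p n ^+ 2 + coshq q 1 ^+ 2.
Proof. by rewrite /den mulrC (coshq_mulDB q_gt0 (2 * n + al0 p) 1). Qed.

Definition row_normsq (i k : int) : R :=
  asq q (idx1 p i - idx2 p k) (alphaL p (idx2 p k)).
Definition col_normsq (i k : int) : R := tasq q (idx2 p k) (alphaM p (idx1 p i)).

Lemma row_normsqE i k : row_normsq i k
  = aw_offdiag q 1 (rung (row_base p) i) (ka k) (A1c p) (A2c p) (ANc p (N1 p)).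
Proof.
rewrite /row_normsq /alphaL asqE // /lam [in sinhq _ (al0 p + _)]addrC.
have -> : 2 * (idx1 p i - idx2 p k) + (al0 p + 2 * idx2 p k)
    = rung (row_base p) i by rewrite /rung /row_base /idx1; field.
by [].
Qed.

Lemma col_normsqE i k : col_normsq i k
  = aw_offdiag q (-1) (rung (col_base p) k) (A0c p) (ANc p (N1 p)) (- la i)
      (ANc p (N2 p)).
Proof.
rewrite /col_normsq /alphaM tasqE // /lam.
have -> : - al0 p - 2 * idx1 p i = - (2 * idx1 p i + al0 p) by ring.
have -> : 2 * idx2 p k + al0 p = rung (col_base p) k.
  by rewrite /rung /col_base /idx2; field.
by rewrite sinhqN.
Qed.

Lemma eq_of_sub_double (x y : R) (a b : int) :
  x - y = 2 * (a - b)%:~R -> (x == y) = (a == b).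
Proof.
by move=> xy; rewrite -subr_eq0 xy mulf_eq0 pnatr_eq0 intr_eq0 subr_eq0.
Qed.

Lemma row_normsq_eq0 i k : (row_normsq i k == 0) =
  [|| i == k, i == k + (N1 p).+1%:Z,
      2 * idx1 p i + al0 p - 1 == al1 p + al2 p
    | 2 * idx1 p i + al0 p - 1 == al1 p - al2 p].
Proof.
rewrite /row_normsq /alphaL asq_eq0 //.
have -> : 2 * (idx1 p i - idx2 p k) + (al0 p + 2 * idx2 p k)
    = 2 * idx1 p i + al0 p by ring.
congr [|| _, _ | _]; apply: eq_of_sub_double.
  by rewrite /idx1 /idx2 intrB natrD; field.
by rewrite /idx1 /idx2 intrB intrD natrD -pmulrn -natr1; field.
Qed.

Lemma col_normsq_eq0 i k : (col_normsq i k == 0) =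
  [|| k == 0, k == (N2 p).+1%:Z, k == i - (N1 p)%:Z | k == i + 1].
Proof.
rewrite /col_normsq /alphaM tasq_eq0 //.
congr [|| _, _, _ | _]; apply: eq_of_sub_double; rewrite /idx1 /idx2 !(intrB, intrD).
- by field.
- by rewrite -pmulrn -natr1; field.
- by rewrite natrD -pmulrn; field.
- by rewrite natrD; field.
Qed.

Definition col_ratio (i : int) : R :=
  mobius_im (coshq q 1) (A1c p) (A2c p) (la i).
Definition row_ratio (k : int) : R :=
  (A0c p * ka k + coshq q 1 * ANc p (N2 p)) / (ka k ^+ 2 + coshq q 1 ^+ 2).

Lemma den_a_neq0 i k : coefs_defined p -> inrange p i k -> inrange p (i - 1) (k - 1) ->
  bL p (idx1 p (i - 1)) (idx2 p (k - 1)) - bL p (idx1 p i) (idx2 p k) != 0.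
Proof.
by move=> [den _] /range12_idxP ik /range12_idxP; rewrite idx1B1 idx2B1; apply: den.
Qed.

Lemma den_c_neq0 i k : coefs_defined p -> inrange p i k -> inrange p (i - 1) (k + 1) ->
  bL p (idx1 p (i - 1)) (idx2 p (k + 1)) - bL p (idx1 p i) (idx2 p k) != 0.
Proof.
by move=> [_ den] /range12_idxP ik /range12_idxP; rewrite idx1B1 idx2D1; apply: den.
Qed.

Lemma bL_mobius i k : bL p (idx1 p i) (idx2 p k)
  = ka k * mobius_re (coshq q 1) (A1c p) (A2c p) (la i) + ANc p (N1 p) * col_ratio i.
Proof.
rewrite bL_aw_diag /aw_diag /col_ratio /mobius_re /mobius_im.
by move: (la i) (ka k) (coshq _ _) => s t c; ring.
Qed.
End CoefficientFunctions.

Section Representation.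
Variables (R : realType) (p : aw_data R).
Local Notation q := (qq p).
Hypothesis q01 : 0 < q < 1.
Variables (V1 V2 W : vectType R[i]) (dot : {dot W for (@Num.conj R[i])}).
Variables (tens : {bilinear V1 -> V2 -> W}) (T : aw2_ops V1 V2 W).
Hypothesis hT : is_AW2_rep p dot tens T.

Let q_gt0 : 0 < q. Proof. by case/andP: q01. Qed.
Let q_lt1 : q < 1. Proof. by case/andP: q01. Qed.

Local Notation la i := (lam p (idx1 p i)).
Local Notation ka k := (lam p (idx2 p k)).
Local Notation c1 := (coshq q 1).

Record adapted_basis (E : int -> int -> W) : Prop := AdaptedBasis {
  ab_out : forall i k, ~~ inrange p i k -> E i k = 0;
  ab_norm : forall i k, inrange p i k -> dot (E i k) (E i k) = 1;
  ab_xK1 : forall i k, xK1 T (E i k) = (ka k)%:C *: E i k;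
  ab_K2 : forall i k, K2 T (E i k) = (la i)%:C *: E i k;
  ab_total : forall w, (forall i k, dot w (E i k) = 0) -> w = 0 }.

Lemma lam_inj : injective (lam p).
Proof. by move=> x y /(sinhq_inj q_gt0 q_lt1)/addIr/mulfI; apply; rewrite pnatr_eq0. Qed.

Lemma comm_xK1_L1x : xK1 T ** L1x T = L1x T ** xK1 T.
Proof. by have [] := AW_comm (A := xK1 T) (rep_K2L1 hT) _; rewrite ?inE ?eqxx. Qed.

Lemma comm_K2_M2 : K2 T ** M2 T = M2 T ** K2 T.
Proof. by have [] := AW_comm (A := M2 T) (rep_K2L2 hT) _; rewrite ?inE ?eqxx ?orbT. Qed.

Lemma comm_M2_L2 : M2 T ** L2 T = L2 T ** M2 T.
Proof. by have [] := AW_comm (A := M2 T) (rep_K2L2 hT) _; rewrite ?inE ?eqxx ?orbT. Qed.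

Lemma comm_L1x_L2 : L1x T ** L2 T = L2 T ** L1x T.
Proof. by have [] := AW_comm (A := L1x T) (rep_K1L2 hT) _; rewrite ?inE ?eqxx ?orbT. Qed.

Section Entries.
Variable E : int -> int -> W.
Hypothesis hE : adapted_basis E.

Lemma ab_orth i k i' k' : (i != i') || (k != k') -> dot (E i k) (E i' k') = 0.
Proof.
have id_comm (A : 'End(W)) : A ** \1%VF = \1%VF ** A.
  by rewrite comp_lfun1r comp_lfun1l.
rewrite -[E i k]id_lfunE => /orP[ii|kk].
  apply: (dot_eigen_distinct (rep_sa_K2 hT) (id_comm _) (ab_K2 hE _ _) (ab_K2 hE _ _)).
  by rewrite (inj_eq lam_inj) (inj_eq (@idx1_inj _ _)).
apply: (dot_eigen_distinct (rep_sa_xK1 hT) (id_comm _) (ab_xK1 hE _ _) (ab_xK1 hE _ _)).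
by rewrite (inj_eq lam_inj) (inj_eq (@idx2_inj _ _)).
Qed.

Lemma ab_unit_or_null i k : unit_or_null dot (E i k).
Proof.
by have [/(ab_norm hE)|/(ab_out hE)] := boolP (inrange p i k); [right | left].
Qed.

Lemma ab_expand w (s : seq (int * int)) : uniq s ->
  (forall i k, (i, k) \notin s -> dot w (E i k) = 0) ->
  w = \sum_(x <- s) dot w (E x.1 x.2) *: E x.1 x.2.
Proof.
move=> uniq_s out_s; apply: (orthogonal_expand (dot := dot)) => //.
- by case=> i k [i' k'] ne; apply: ab_orth; rewrite -negb_and -xpair_eqE.
- by case=> i k; apply: ab_unit_or_null.
- by move=> v v0; apply: (ab_total hE) => i k; apply: (v0 (i, k)).
- by case=> i k /out_s.
Qed.

Lemma K2_tridiag (A B0 B1 B2 B3 B4 : 'End(W)) i k i' k' :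
  AW q (K2 T) A B0 B1 B2 B3 B4 (scal W (sigc p)) -> 1 < `|i - i'| ->
  dot (A (E i k)) (E i' k') = 0.
Proof.
move=> awK far; have far' : 1 < `|i' - i| by lia.
apply: (AW_tridiag q_gt0 (rep_sa_K2 hT) q_lt1 awK far' _ (ab_K2 hE _ _) (ab_K2 hE _ _)).
by rewrite /idx1 intrB; ring.
Qed.

Lemma xK1_tridiag (A B0 B1 B2 B3 B4 : 'End(W)) i k i' k' :
  AW q (xK1 T) A B0 B1 B2 B3 B4 (scal W (sigc p)) -> 1 < `|k - k'| ->
  dot (A (E i k)) (E i' k') = 0.
Proof.
move=> awK far; have far' : 1 < `|k' - k| by lia.
apply: (AW_tridiag q_gt0 (rep_sa_xK1 hT) q_lt1 awK far' _ (ab_xK1 hE _ _)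
  (ab_xK1 hE _ _)).
by rewrite /idx2 intrB; ring.
Qed.

Lemma L1x_tridiag i k : L1x T (E i k) = lower1 dot E (L1x T) i k *: E (i - 1) k
  + dot (L1x T (E i k)) (E i k) *: E i k
  + dot (L1x T (E i k)) (E (i + 1) k) *: E (i + 1) k.
Proof.
rewrite [LHS](@ab_expand _ [:: (i - 1, k); (i, k); (i + 1, k)]).
- by rewrite !big_cons big_nil /= addr0 addrA.
- by rewrite /= !inE !xpair_eqE; lia.
- move=> i' k'; rewrite !inE !xpair_eqE => out.
  have [kk|kk] := eqVneq k' k; first by apply: (K2_tridiag _ _ (rep_K2L1 hT)); lia.
  apply: (dot_eigen_distinct (rep_sa_xK1 hT) comm_xK1_L1x (ab_xK1 hE _ _)
    (ab_xK1 hE _ _)).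
  by rewrite (inj_eq lam_inj) (inj_eq (@idx2_inj _ _)) eq_sym.
Qed.

Lemma M2_tridiag i k : M2 T (E i k) = lower2 dot E (M2 T) i k *: E i (k - 1)
  + dot (M2 T (E i k)) (E i k) *: E i k
  + dot (M2 T (E i k)) (E i (k + 1)) *: E i (k + 1).
Proof.
rewrite [LHS](@ab_expand _ [:: (i, k - 1); (i, k); (i, k + 1)]).
- by rewrite !big_cons big_nil /= addr0 addrA.
- by rewrite /= !inE !xpair_eqE; lia.
- move=> i' k'; rewrite !inE !xpair_eqE => out.
  have [ii|ii] := eqVneq i' i; first by apply: (xK1_tridiag _ _ (rep_K1M2 hT)); lia.
  apply: (dot_eigen_distinct (rep_sa_K2 hT) comm_K2_M2 (ab_K2 hE _ _) (ab_K2 hE _ _)).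
  by rewrite (inj_eq lam_inj) (inj_eq (@idx1_inj _ _)) eq_sym.
Qed.

Let awL1 : AW q (K2 T) (L1x T) (xK1 T) (scal W (A1c p)) (scal W (A2c p))
  (scal W (ANc p (N1 p))) (scal W (1 * sinhq q 1 ^+ 2)) (scal W (sinhq q 1 ^+ 2)).
Proof. by rewrite mul1r; exact: (rep_K2L1 hT). Qed.

Let awM2 : AW q (xK1 T) (M2 T) (scal W (A0c p)) (scal W (ANc p (N1 p))) (- K2 T)
  (scal W (ANc p (N2 p))) (scal W (-1 * sinhq q 1 ^+ 2)) (scal W (sinhq q 1 ^+ 2)).
Proof. by rewrite mulN1r; exact: (rep_K1M2 hT). Qed.

Let K2_row k i : K2 T (E i k) = (sinhq q (rung (row_base p) i))%:C *: E i k.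
Proof. by rewrite (ab_K2 hE) lam_idx1. Qed.

Let xK1_col i k : xK1 T (E i k) = (sinhq q (rung (col_base p) k))%:C *: E i k.
Proof. by rewrite (ab_xK1 hE) lam_idx2. Qed.

Let NK2_col i k : (- K2 T) (E i k) = (- la i)%:C *: E i k.
Proof. by rewrite opp_lfunE (ab_K2 hE) rmorphN scaleNr. Qed.

Lemma L1x_diag i k : dot (L1x T (E i k)) (E i k)
  = (bL p (idx1 p i) (idx2 p k))%:C * dot (E i k) (E i k).
Proof.
rewrite bL_aw_diag // lam_idx1.
exact: (ladder_diag (f := E^~ k) q_gt0 q_lt1 (rep_sa_K2 hT) awL1 (K2_row k)
  (fun i => ab_xK1 hE i k) (fun=> scalE _ _) (fun=> scalE _ _) (fun=> scalE _ _)).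
Qed.

Lemma M2_diag i k : dot (M2 T (E i k)) (E i k)
  = (tbcoef q (idx2 p k) (alphaM p (idx1 p i)))%:C * dot (E i k) (E i k).
Proof.
rewrite tbcoef_aw_diag // lam_idx2.
exact: (ladder_diag (f := E i) q_gt0 q_lt1 (rep_sa_xK1 hT) awM2 (xK1_col i)
  (fun=> scalE _ _) (fun=> scalE _ _) (NK2_col i) (fun=> scalE _ _)).
Qed.

Lemma lower1_normsq i k : inrange p i k || inrange p (i - 1) k ->
  `|lower1 dot E (L1x T) i k| ^+ 2 = (row_normsq p i k)%:C.
Proof.
rewrite /inrange => ik; rewrite row_normsqE //.
apply: (ladder_normsq (f := E^~ k) q_gt0 q_lt1 (rep_sa_K2 hT) (rep_sa_L1x hT) awL1
  (K2_row k) (fun i => ab_xK1 hE i k) (fun=> scalE _ _) (fun=> scalE _ _)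
  (fun=> scalE _ _) (fun i => L1x_tridiag i k) (lo := k) (hi := k + (N1 p)%:Z)).
- by move=> j kj; apply: (ab_norm hE); rewrite /inrange; lia.
- by apply: (ab_out hE); rewrite /inrange; lia.
- by apply/eqP; rewrite -row_normsqE // row_normsq_eq0 // eqxx.
- lia.
Qed.

Lemma lower2_normsq i k : inrange p i k || inrange p i (k - 1) ->
  `|lower2 dot E (M2 T) i k| ^+ 2 = (col_normsq p i k)%:C.
Proof.
rewrite /inrange => ik; rewrite col_normsqE //.
pose lo : int := Num.max 0 (i - (N1 p)%:Z); pose hi : int := Num.min (N2 p)%:Z i.
apply: (ladder_normsq (f := E i) q_gt0 q_lt1 (rep_sa_xK1 hT) (rep_sa_M2 hT) awM2
  (xK1_col i) (fun=> scalE _ _) (fun=> scalE _ _) (NK2_col i) (fun=> scalE _ _)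
  (M2_tridiag i) (lo := lo) (hi := hi)); rewrite /lo /hi.
- by move=> j kj; apply: (ab_norm hE); rewrite /inrange; lia.
- by apply: (ab_out hE); rewrite /inrange; lia.
- by apply/eqP; rewrite -col_normsqE // col_normsq_eq0 //; lia.
- lia.
Qed.

Lemma L2_row i i' k : i != i' -> dot (L2 T (E i k)) (E i' k)
  = (row_ratio p k)%:C * dot (L1x T (E i k)) (E i' k).
Proof.
move=> ii; apply: eq_div_realC; first exact: aw_den_neq0.
rewrite (AW_eigenspace_entry q_gt0 (rep_sa_xK1 hT) q_lt1 (rep_K1L2 hT)
  (ab_xK1 hE i k) (ab_xK1 hE i' k)).
rewrite !(endE, dotE) ab_orth ?ii // -/(lam p (idx2 p k)).
move: (dot _ _) (lam _ _) (A0c p) (A2c p) (ANc p _) (coshq _ _) => *.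
by rewrite !(rmorphD, rmorphM) /=; ring.
Qed.

Lemma L2_col i k k' : k != k' -> dot (L2 T (E i k)) (E i k')
  = (col_ratio p i)%:C * dot (M2 T (E i k)) (E i k').
Proof.
move=> kk; apply: eq_div_realC; first exact: aw_den_neq0.
rewrite (AW_eigenspace_entry q_gt0 (rep_sa_K2 hT) q_lt1 (rep_K2L2 hT)
  (ab_K2 hE i k) (ab_K2 hE i k')).
rewrite !(endE, dotE) ab_orth ?kk ?orbT // -/(lam p (idx1 p i)).
move: (dot _ _) (lam _ _) (A0c p) (A1c p) (A2c p) (coshq _ _) => *.
by rewrite !(rmorphB, rmorphM) /=; ring.
Qed.

Lemma L2_diag i k : dot (L2 T (E i k)) (E i k)
  = coef_e p (idx1 p i) (idx2 p k) * dot (E i k) (E i k).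
Proof.
rewrite /coef_e denE //; apply: eq_div_realC; first exact: aw_den_neq0.
rewrite (AW_eigenspace_entry q_gt0 (rep_sa_K2 hT) q_lt1 (rep_K2L2 hT)
  (ab_K2 hE i k) (ab_K2 hE i k)).
rewrite !(endE, dotE) M2_diag -/(lam p (idx1 p i)).
move: (dot _ _) (lam _ _) (tbcoef _ _ _) (A0c p) (A1c p) (A2c p) (coshq _ _).
by move=> *; rewrite !(rmorphD, rmorphB, rmorphM) /=; ring.
Qed.

Lemma adapted_frame : lattice_frame dot E (L1x T) (M2 T) (L2 T)
  (fun i k => bL p (idx1 p i) (idx2 p k))
  (fun i k => tbcoef q (idx2 p k) (alphaM p (idx1 p i)))
  (col_ratio p) (row_ratio p).
Proof.
split.
- exact: ab_orth.
- exact: ab_unit_or_null.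
- move=> i k; rewrite [LHS]L1x_tridiag L1x_diag -scalerA unit_or_null_scale //.
  exact: ab_unit_or_null.
- move=> i k; rewrite [LHS]M2_tridiag M2_diag -scalerA unit_or_null_scale //.
  exact: ab_unit_or_null.
- move=> i k i' k' /orP[] far.
    exact: (K2_tridiag _ _ (rep_K2L2 hT) far).
  exact: (xK1_tridiag _ _ (rep_K1L2 hT) far).
- exact: L2_row.
- exact: L2_col.
Qed.

Lemma lower1_out i k : ~~ (inrange p i k && inrange p (i - 1) k) ->
  lower1 dot E (L1x T) i k = 0.
Proof.
rewrite negb_and /lower1 => /orP[] /(ab_out hE) ->; last exact: linear0r.
by rewrite linear0 linear0l.
Qed.

Lemma lower2_neq0 i k : inrange p i k -> inrange p i (k - 1) ->
  lower2 dot E (M2 T) i k != 0.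
Proof.
move=> ik ik'; rewrite (normsq_realC_eq0 (lower2_normsq _)) ?ik //.
by rewrite col_normsq_eq0 //; move: ik ik'; rewrite /inrange; lia.
Qed.

Lemma lower1_eq0 i k k' : inrange p i k -> inrange p (i - 1) k ->
  inrange p i k' -> inrange p (i - 1) k' ->
  (lower1 dot E (L1x T) i k == 0) = (lower1 dot E (L1x T) i k' == 0).
Proof.
move=> ik i1k ik' i1k'; rewrite !(normsq_realC_eq0 (lower1_normsq _)) ?ik ?ik' //.
rewrite !row_normsq_eq0 //.
move: ik i1k ik' i1k'; rewrite /inrange => ik i1k ik' i1k'.
by congr orb; [lia | congr orb; lia].
Qed.

Lemma path_product_real i k : coefs_defined p ->
  inrange p i k -> inrange p (i - 1) k ->
  inrange p i (k - 1) -> inrange p (i - 1) (k - 1) ->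
  complex.Im (row_col_path dot E (L1x T) (M2 T) i k
              * (col_row_path dot E (L1x T) (M2 T) i k)^*) = 0.
Proof.
move=> defined ik i1k ik1 i1k1; apply/eqP/negPn/negP => PQ.
have [awML _ _] := rep_M2L1 hT.
have den_a := den_a_neq0 defined ik i1k1.
have := den_c_neq0 defined (i := i) (k := k - 1); rewrite subrK => /(_ ik1 i1k) den_c.
have [row diag] := plaquette_proportional (rep_sa_L1x hT) (rep_sa_M2 hT) adapted_frame
  q_gt0 comm_L1x_L2 comm_M2_L2 awML den_a PQ.
have [row' antidiag] := plaquette_proportional_reflect (rep_sa_L1x hT) (rep_sa_M2 hT)
  adapted_frame q_gt0 comm_L1x_L2 comm_M2_L2 awML den_c PQ.
rewrite !bL_mobius // in diag antidiag.
apply: (@plaquette_nondegenerate _ c1 (A1c p) (A2c p) _ _ (A0c p) (ANc p (N2 p))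
  (ANc p (N1 p)) (coshq q 2) (la (i - 1)) (la i) (ka (k - 1)) (ka k)
  _ _ _ _ row row' diag antidiag).
- exact: coshq_gt0.
- exact: coshq_neq0.
- exact: coshq_neq0.
- exact: coshq_gt0.
- by rewrite (inj_eq lam_inj) (inj_eq (@idx1_inj _ _)); clear; lia.
- by rewrite (inj_eq lam_inj) (inj_eq (@idx2_inj _ _)); clear; lia.
Qed.
End Entries.
Lemma adapted_scale E (th : int -> int -> R[i]) : adapted_basis E ->
  (forall i k, `|th i k| = 1) -> adapted_basis (fun i k => th i k *: E i k).
Proof.
move=> [out norm eig_xK1 eig_K2 total] th1; split=> [i k ik|i k ik|i k|i k|w w_orth].
- by rewrite out // scaler0.
- by rewrite !dotE norm // mulr1 unit_mul_conj.
- by rewrite lfunZ eig_xK1 scalerA mulrC -scalerA.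
- by rewrite lfunZ eig_K2 scalerA mulrC -scalerA.
- apply: total => i k; have /eqP := w_orth i k.
  by rewrite dotZr mulf_eq0 conjC_eq0 -normr_eq0 th1 oner_eq0 => /eqP.
Qed.

Hypothesis defined : coefs_defined p.

Lemma adapted_gauge E : adapted_basis E ->
  exists th : int -> int -> R[i], [/\ forall i k, `|th i k| = 1,
    forall i k, lower1 dot (fun i k => th i k *: E i k) (L1x T) i k \is Num.real &
    forall i k, lower2 dot (fun i k => th i k *: E i k) (M2 T) i k \is Num.real].
Proof.
move=> hE; have l_in i k : lower1 dot E (L1x T) i k != 0 ->
    inrange p i k /\ inrange p (i - 1) k.
  by move=> l0; apply/andP; apply: contraNT l0 => /(lower1_out hE) ->.
have [i j k jk|i k|th [th1 l_real m_real]] :=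
    @lattice_gauge _ (lower1 dot E (L1x T)) (lower2 dot E (M2 T)).
- move=> l_j l_k; have [[ij i1j] [ik i1k]] := (l_in i j l_j, l_in i k l_k).
  rewrite (lower1_eq0 hE (k' := k)) //; by move: ij i1j ik i1k; rewrite /inrange; lia.
- move=> /l_in[ik i1k] /l_in[ik1 i1k1]; rewrite !(lower2_neq0 hE) //; split=> //.
  have := path_product_real hE defined ik i1k ik1 i1k1.
  by case: (_ * _) => x y /= ->; rewrite complex_real.
- by exists th; split=> // i k; rewrite ?lower1_scale ?lower2_scale.
Qed.

Section Coefficients.
Variable E : int -> int -> W.
Hypothesis hE : adapted_basis E.
Local Notation l := (lower1 dot E (L1x T)).
Local Notation m := (lower2 dot E (M2 T)).
Hypotheses (l_real : forall i k, l i k \is Num.real)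
  (m_real : forall i k, m i k \is Num.real).

Lemma row_sqrt : exists ra : R -> R * R * R * R -> R[i], is_sqrt (asq q) ra /\
  forall i k, inrange p i k || inrange p (i - 1) k ->
    aL p ra (idx1 p i) (idx2 p k) = l i k.
Proof.
have [|[i k] ik|ra [ra_sqrt raE]] := sqrt_extend (f := asq q)
    (D := fun x => inrange p x.1 x.2 || inrange p (x.1 - 1) x.2)
    (x := fun x => (idx1 p x.1 - idx2 p x.2, alphaL p (idx2 p x.2)))
    (z := fun x => l x.1 x.2).
- move=> [i k] [i' k'] /= [idxE alE]; have kk : k = k' by apply: (@idx2_inj _ p); lra.
  by rewrite kk in idxE *; congr (_, _); move/addIr: idxE => /idx1_inj.
- by rewrite -real_normK // lower1_normsq.
- by exists ra; split=> // i k ik; apply: (raE (i, k)).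
Qed.

Lemma col_sqrt : exists rta : R -> R * R * R * R -> R[i], is_sqrt (tasq q) rta /\
  forall i k, inrange p i k || inrange p i (k - 1) ->
    rta (idx2 p k) (alphaM p (idx1 p i)) = m i k.
Proof.
have [|[i k] ik|rta [rta_sqrt rtaE]] := sqrt_extend (f := tasq q)
    (D := fun x => inrange p x.1 x.2 || inrange p x.1 (x.2 - 1))
    (x := fun x => (idx2 p x.2, alphaM p (idx1 p x.1)))
    (z := fun x => m x.1 x.2).
- move=> [i k] [i' k'] /= [/idx2_inj -> alE].
  by congr (_, _); apply: (@idx1_inj _ p); lra.
- by rewrite -real_normK // lower2_normsq.
- by exists rta; split=> // i k ik; apply: (rtaE (i, k)).
Qed.

Variables ra rta : R -> R * R * R * R -> R[i].
Hypothesis raE : forall i k, inrange p i k || inrange p (i - 1) k ->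
  aL p ra (idx1 p i) (idx2 p k) = l i k.
Hypothesis rtaE : forall i k, inrange p i k || inrange p i (k - 1) ->
  rta (idx2 p k) (alphaM p (idx1 p i)) = m i k.

Lemma coef_bE i k : inrange p i k ->
  coef_b p ra (idx1 p i) (idx2 p k) = (row_ratio p k)%:C * l i k.
Proof. by move=> ik; rewrite /coef_b raE ?ik // denE // -mulrA -fmorph_div mulrC. Qed.

Lemma coef_dE i k : inrange p i k || inrange p i (k - 1) ->
  coef_d p rta (idx1 p i) (idx2 p k) = (col_ratio p i)%:C * m i k.
Proof. by move=> ik; rewrite /coef_d rtaE // denE // -mulrA -fmorph_div mulrC. Qed.

Lemma L2_entry_b i k : inrange p i k ->
  dot (L2 T (E i k)) (E (i - 1) k) = coef_b p ra (idx1 p i) (idx2 p k).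
Proof. by move=> ik; rewrite coef_bE // (L2_row hE) //; clear; lia. Qed.

Lemma L2_entry_d i k : inrange p i k ->
  dot (L2 T (E i k)) (E i (k - 1)) = coef_d p rta (idx1 p i) (idx2 p k).
Proof. by move=> ik; rewrite coef_dE ?ik // (L2_col hE) //; clear; lia. Qed.

Lemma L2_entry_a i k : inrange p i k -> inrange p (i - 1) (k - 1) ->
  dot (L2 T (E i k)) (E (i - 1) (k - 1)) = coef_a p ra rta (idx1 p i) (idx2 p k).
Proof.
move=> ik i1k1; have den := den_a_neq0 defined ik i1k1.
rewrite /coef_a /den_a -idx1B1 -idx2B1 !coef_dE ?raE ?ik ?i1k1 ?orbT //.
apply: canRL (mulfK _) _; first by rewrite fmorph_eq0.
rewrite (frame_corner (rep_sa_L1x hT) (adapted_frame hE) i k comm_L1x_L2).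
by rewrite /row_col_path /col_row_path; ring.
Qed.

Lemma L2_entry_c i k : inrange p i k -> inrange p (i - 1) (k + 1) ->
  dot (L2 T (E i k)) (E (i - 1) (k + 1)) = coef_c p ra rta (idx1 p i) (idx2 p k).
Proof.
move=> ik i1k1; have den := den_c_neq0 defined ik i1k1.
rewrite /coef_c /den_c -idx1B1 -idx2D1 !coef_dE ?raE ?addrK ?ik ?i1k1 ?orbT //.
apply: canRL (mulfK _) _; first by rewrite fmorph_eq0.
rewrite (frame_anticorner i k (rep_sa_L1x hT) (rep_sa_M2 hT) (adapted_frame hE)
  comm_L1x_L2).
by rewrite !conj_Creal //; ring.
Qed.

Let realC (x : R) : x%:C \is Num.real.
Proof. by rewrite complex_real. Qed.

Lemma coef_b_real i k : inrange p i k -> coef_b p ra (idx1 p i) (idx2 p k) \is Num.real.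
Proof. by move=> ik; rewrite coef_bE // realM. Qed.

Lemma coef_d_real i k : inrange p i k || inrange p i (k - 1) ->
  coef_d p rta (idx1 p i) (idx2 p k) \is Num.real.
Proof. by move=> ik; rewrite coef_dE // realM. Qed.

Lemma coef_a_real i k : inrange p i k -> inrange p (i - 1) (k - 1) ->
  coef_a p ra rta (idx1 p i) (idx2 p k) \is Num.real.
Proof.
move=> ik i1k1; rewrite /coef_a -idx1B1 -idx2B1 !raE ?ik ?i1k1 ?orbT //.
by rewrite rpred_div // rpredB // realM // coef_d_real // ?ik ?i1k1 ?orbT.
Qed.

Lemma coef_c_real i k : inrange p i k -> inrange p (i - 1) (k + 1) ->
  coef_c p ra rta (idx1 p i) (idx2 p k) \is Num.real.
Proof.
move=> ik i1k1; rewrite /coef_c -idx1B1 -idx2D1 !raE ?ik ?i1k1 ?orbT //.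
by rewrite rpred_div // rpredB // realM // coef_d_real // ?addrK ?ik ?i1k1 ?orbT.
Qed.

Lemma L2_entry_sym i k i' k' x : dot (L2 T (E i' k')) (E i k) = x ->
  x \is Num.real -> dot (L2 T (E i k)) (E i' k') = x.
Proof. by move=> <- /conj_Creal; rewrite -dotC -(rep_sa_L2 hT). Qed.

Lemma L2_nine_term i k : inrange p i k ->
  let n1 := idx1 p i in let n2 := idx2 p k in
  let a := coef_a p ra rta in let b := coef_b p ra in
  let c := coef_c p ra rta in let d := coef_d p rta in
  L2 T (E i k) =
      a n1 n2 *: E (i - 1) (k - 1) + b n1 n2 *: E (i - 1) k
    + c n1 n2 *: E (i - 1) (k + 1) + d n1 n2 *: E i (k - 1)
    + coef_e p n1 n2 *: E i k + d n1 (n2 + 1) *: E i (k + 1)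
    + c (n1 + 1) (n2 - 1) *: E (i + 1) (k - 1) + b (n1 + 1) n2 *: E (i + 1) k
    + a (n1 + 1) (n2 + 1) *: E (i + 1) (k + 1).
Proof.
move=> ik n1 n2 a b c d.
have term i' k' x : (inrange p i' k' -> dot (L2 T (E i k)) (E i' k') = x) ->
    dot (L2 T (E i k)) (E i' k') *: E i' k' = x *: E i' k'.
  have [ik' -> //|/(ab_out hE) -> _] := boolP (inrange p i' k').
  by rewrite !scaler0.
rewrite [LHS](@ab_expand _ hE _ [:: (i - 1, k - 1); (i - 1, k); (i - 1, k + 1);
  (i, k - 1); (i, k); (i, k + 1); (i + 1, k - 1); (i + 1, k); (i + 1, k + 1)]).
- rewrite !big_cons big_nil /= addr0 !addrA /n1 /n2 -!(idx1D1, idx2D1, idx2B1).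
  rewrite (term _ _ (a n1 n2)); last exact: L2_entry_a.
  rewrite (term (i - 1) k (b n1 n2)); last by move=> _; exact: L2_entry_b.
  rewrite (term _ _ (c n1 n2)); last exact: L2_entry_c.
  rewrite (term i (k - 1) (d n1 n2)); last by move=> _; exact: L2_entry_d.
  rewrite (term i k (coef_e p n1 n2)); last first.
    by move=> _; rewrite (L2_diag hE) (ab_norm hE ik) mulr1.
  rewrite (term i (k + 1) (d n1 (idx2 p (k + 1)))); last first.
    move=> ik'; have := L2_entry_d ik'; rewrite addrK => /L2_entry_sym; apply.
    by apply: coef_d_real; rewrite ik'.
  rewrite (term (i + 1) (k - 1) (c (idx1 p (i + 1)) (idx2 p (k - 1)))); last first.
    move=> ik'; have := L2_entry_c ik'.
    rewrite addrK subrK => /(_ ik)/L2_entry_sym; apply.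
    by apply: coef_c_real; rewrite ?addrK ?subrK.
  rewrite (term (i + 1) k (b (idx1 p (i + 1)) n2)); last first.
    move=> ik'; have := L2_entry_b ik'; rewrite addrK => /L2_entry_sym; apply.
    exact: coef_b_real.
  rewrite (term (i + 1) (k + 1) (a (idx1 p (i + 1)) (idx2 p (k + 1)))) // => ik'.
  have := L2_entry_a ik'; rewrite !addrK => /(_ ik)/L2_entry_sym; apply.
  by apply: coef_a_real; rewrite ?addrK.
- by rewrite /= !inE !xpair_eqE; clear; lia.
- move=> i' k'; rewrite !inE !xpair_eqE => out; apply: (lf_far (adapted_frame hE)).
  by move: out; clear; lia.
Qed.
End Coefficients.
End Representation.

(** * The nine-term formula *)

Lemma orthonormal_span (R : realType) (V : vectType R[i])
    (dot : {dot V for (@Num.conj R[i])}) (n : nat) (f : 'I_n -> V) :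
  \dim {:V} = n -> (forall i j, dot (f i) (f j) = (i == j)%:R) ->
  forall v, exists c : 'I_n -> R[i], v = \sum_j c j *: f j.
Proof.
move=> dimV f_orth v; pose X := [tuple f j | j < n].
have XE (j : 'I_n) : X`_j = f j by rewrite -tnth_nth tnth_mktuple.
have free_X : free X.
  apply/freeP => c c_eq0 j; have : dot (\sum_i c i *: X`_i) (f j) = 0.
    by rewrite c_eq0 linear0l.
  rewrite linear_sumlz /= (bigD1 j) //= big1 => [|i ij].
    by rewrite dotZl XE f_orth eqxx mulr1 addr0.
  by rewrite dotZl XE f_orth (negPf ij) mulr0.
have basis_X : basis_of fullv X by rewrite basisEfree free_X subvf size_tuple dimV leqnn.
exists (fun j => coord X j v); rewrite {1}(coord_basis basis_X (memvf v)).
by apply: eq_bigr => j _; rewrite XE.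
Qed.

Section Eigenbasis.
Variables (R : realType) (p : aw_data R) (V1 V2 W : vectType R[i]).
Variables (dot1 : {dot V1 for (@Num.conj R[i])}).
Variables (dot2 : {dot V2 for (@Num.conj R[i])}).
Variables (dot : {dot W for (@Num.conj R[i])}).
Variables (tens : {bilinear V1 -> V2 -> W}) (T : aw2_ops V1 V2 W).
Hypothesis htens : is_tensor_product dot1 dot2 dot tens.

Lemma tens_total (n1 n2 : nat) (f1 : 'I_n2 -> 'I_n1 -> V1) (f2 : 'I_n2 -> V2) w :
  (forall v, exists c : 'I_n2 -> R[i], v = \sum_k c k *: f2 k) ->
  (forall k u, exists c : 'I_n1 -> R[i], u = \sum_j c j *: f1 k j) ->
  (forall k j, dot w (tens (f1 k j) (f2 k)) = 0) -> w = 0.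
Proof.
move=> span2 span1 w_orth; have w_tens u v : dot w (tens u v) = 0.
  have [c ->] := span2 v; rewrite !linear_sumr /= big1 // => k _.
  have [d ->] := span1 k u; rewrite linearZr_LR /= dotZr.
  rewrite linear_sumlz /= linear_sumr /= big1 ?mulr0 // => j _.
  by rewrite linearZl_LR /= dotZr w_orth mulr0.
have [s wE] := htens.1 w; apply/eqP; rewrite -(dnorm_eq0 dot) {2}wE linear_sumr /=.
by rewrite big1_seq // => x _; apply: w_tens.
Qed.

Hypotheses (hdim1 : \dim {:V1} = (N1 p).+1) (hdim2 : \dim {:V2} = (N2 p).+1).
Hypothesis hT : is_AW2_rep p dot tens T.
Variables (psi1 : R -> R -> V1) (psi2 : R -> V2).
Hypothesis hpsi : is_eigenbasis p dot1 dot2 tens T psi1 psi2.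

Lemma eigenbasis_adapted : adapted_basis p dot T
  (fun i k => tens (psi1 (idx1 p i) (idx2 p k)) (psi2 (idx2 p k))).
Proof.
have out i k : ~~ inrange p i k ->
    tens (psi1 (idx1 p i) (idx2 p k)) (psi2 (idx2 p k)) = 0.
  by move/negP=> ik; rewrite (psi1_out hpsi) ?linear0l // => /range12_idxP.
split=> [//|i k /range12_idxP ik|i k|i k|w w_orth].
- by rewrite htens.2 (psi1_on hpsi) // (psi2_on hpsi) ?eqxx ?mulr1 //; case: ik.
- have [/range12_idxP[k_in _]|/out ->] := boolP (inrange p i k).
    by rewrite (rep_xK1 hT) id_lfunE (psi2_eig hpsi) // linearZr_LR.
  by rewrite linear0 scaler0.
- have [/range12_idxP|/out ->] := boolP (inrange p i k); first exact: (psi1_eig hpsi).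
  by rewrite linear0 scaler0.
- have inrangeE (k : 'I_(N2 p).+1) (j : 'I_(N1 p).+1) :
      range12 p (idx1 p (k%:Z + j%:Z)) (idx2 p k%:Z).
    by apply/range12_idxP; have := ltn_ord k; have := ltn_ord j; rewrite /inrange; lia.
  apply: (tens_total (f1 := fun k j => psi1 (idx1 p (k%:Z + j%:Z)) (idx2 p k%:Z))
    (f2 := fun k => psi2 (idx2 p k%:Z)) _ _ (fun k j => w_orth (k%:Z + j%:Z) k%:Z)).
    apply: (orthonormal_span (dot := dot2) hdim2) => k k'.
    have [[k_in _] [k'_in _]] := (inrangeE k ord0, inrangeE k' ord0).
    by rewrite /= (psi2_on hpsi) // (inj_eq (@idx2_inj _ _)).
  move=> k; apply: (orthonormal_span (dot := dot1) hdim1) => j j'.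
  by rewrite /= (psi1_on hpsi) // (inj_eq (@idx1_inj _ _)) (inj_eq (addrI _)).
Qed.
End Eigenbasis.

Theorem theorem5p5 (R : realType) (p : aw_data R) (hq : 0 < qq p < 1)
  (V1 V2 W : vectType R[i])
  (dot1 : {dot V1 for (@Num.conj R[i])})
  (dot2 : {dot V2 for (@Num.conj R[i])})
  (dotW : {dot W for (@Num.conj R[i])})
  (tens : {bilinear V1 -> V2 -> W})
  (hdim1 : \dim {:V1} = (N1 p).+1) (hdim2 : \dim {:V2} = (N2 p).+1)
  (htens : is_tensor_product dot1 dot2 dotW tens)
  (T : aw2_ops V1 V2 W) (hT : is_AW2_rep p dotW tens T)
  (psi1 : R -> R -> V1) (psi2 : R -> V2)
  (hpsi : is_eigenbasis p dot1 dot2 tens T psi1 psi2)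
  (hden : coefs_defined p) :
  exists (theta : R -> R -> R[i]) (ra rta : R -> R * R * R * R -> R[i]),
    let Psi n1 n2 := tens (theta n1 n2 *: psi1 n1 n2) (psi2 n2) in
    let a := coef_a p ra rta in
    let b := coef_b p ra in
    let c := coef_c p ra rta in
    let d := coef_d p rta in
    let e := coef_e p in
    [/\ forall n1 n2, `|theta n1 n2| = 1,
        is_sqrt (asq (qq p)) ra,
        is_sqrt (tasq (qq p)) rta
      & forall n1 n2, range12 p n1 n2 ->
        L2 T (Psi n1 n2) =
            a n1 n2 *: Psi (n1 - 1) (n2 - 1)
          + b n1 n2 *: Psi (n1 - 1) n2
          + c n1 n2 *: Psi (n1 - 1) (n2 + 1)
          + d n1 n2 *: Psi n1 (n2 - 1)
          + e n1 n2 *: Psi n1 n2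
          + d n1 (n2 + 1) *: Psi n1 (n2 + 1)
          + c (n1 + 1) (n2 - 1) *: Psi (n1 + 1) (n2 - 1)
          + b (n1 + 1) n2 *: Psi (n1 + 1) n2
          + a (n1 + 1) (n2 + 1) *: Psi (n1 + 1) (n2 + 1)].
Proof.
have adapted := eigenbasis_adapted htens hdim1 hdim2 hT hpsi.
have [th [th1 l_real m_real]] := adapted_gauge hq hT hden adapted.
have {}adapted := adapted_scale adapted th1.
have [ra [ra_sqrt raE]] := row_sqrt hq hT adapted l_real.
have [rta [rta_sqrt rtaE]] := col_sqrt hq hT adapted m_real.
have [|||f [f1 fE]] := choice_extend (P := fun _ z => `|z| = 1) (D := fun=> True)
    (x := fun x => (idx1 p x.1, idx2 p x.2)) (z := fun x => th x.1 x.2).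
- by move=> [i k] [i' k'] /= [/idx1_inj -> /idx2_inj ->].
- by move=> t; exists 1; rewrite normr1.
- by move=> [i k] _.
exists (fun n1 n2 => f (n1, n2)), ra, rta => Psi a b c d e.
split=> // n1 n2 n_range; have [i [k [n1E n2E]]] := range12_idx n_range.
move: n_range; rewrite n1E n2E => /range12_idxP ik.
have PsiE j n : Psi (idx1 p j) (idx2 p n)
    = th j n *: tens (psi1 (idx1 p j) (idx2 p n)) (psi2 (idx2 p n)).
  by rewrite /Psi linearZl_LR /= (fE (j, n) I).
have := L2_nine_term hq hT hden adapted l_real m_real raE rtaE ik.
by rewrite -!PsiE /= !(idx1B1, idx1D1, idx2B1, idx2D1) => ->.
Qed.
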